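(* Let $d\ge 1$, let $b\in C^1_\sharp(Y_d)^d$ and let $\mu\in\mathscr{M}_p(Y_d)$. Define the Radon measure $\tilde\mu$ on $\mathbb{R}^d$ by $$\int_{\mathbb{R}^d}\varphi(x)\,d\tilde\mu(x):=\int_{Y_d}\varphi_\sharp(y)\,d\mu(y),\quad\text{where}\quad \varphi_\sharp(\cdot):=\sum_{k\in\mathbb{Z}^d}\varphi(\cdot+k),\quad\text{for }\varphi\in C^0_c(\mathbb{R}^d).$$ Then $\mu$ is invariant for the flow $T_t$ associated with $b$ if, and only if, one of the two following conditions is satisfied (that is, the invariance of $\mu$, condition (a) and condition (b) are all equivalent): (a) $\operatorname{div}(\tilde\mu\,b)=0$ in $\mathscr{D}'(\mathbb{R}^d)$; (b) for all $\psi\in C^1_\sharp(Y_d)$, $\displaystyle\int_{Y_d} b(y)\cdot\nabla\psi(y)\,d\mu(y)=0$.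
   Context: $Y_d:=\mathbb{R}^d/\mathbb{Z}^d$ is the $d$-dimensional torus, identified with the cube $[0,1)^d$. $C^k_\sharp(Y_d)$ is the space of real-valued functions in $C^k(\mathbb{R}^d)$ which are $\mathbb{Z}^d$-periodic. $C^k_c(\mathbb{R}^d)$ is the space of real-valued functions in $C^k(\mathbb{R}^d)$ with compact support. $\mathscr{M}_p(Y_d)$ is the space of (Borel) probability measures on $Y_d$. $\mathscr{D}'(\mathbb{R}^d)$ is the space of distributions on $\mathbb{R}^d$; $\operatorname{div}(\tilde\mu\,b)=0$ in $\mathscr{D}'(\mathbb{R}^d)$ means $\int_{\mathbb{R}^d}b(x)\cdot\nabla\varphi(x)\,d\tilde\mu(x)=0$ for every test function $\varphi\in C^\infty_c(\mathbb{R}^d)$ (equivalently, for every $\varphi\in C^1_c(\mathbb{R}^d)$). For $b\in C^1_\sharp(Y_d)^d$ and $x\in\mathbb{R}^d$, $X(\cdot,x)$ denotes the unique solution, defined on all of $\mathbb{R}$ with values in $\mathbb{R}^d$, of $\frac{\partial X}{\partial t}(t,x)=b(X(t,x))$ for $t\in\mathbb{R}$, $X(0,x)=x$. It satisfies $X(t,x+k)=X(t,x)+k$ for $k\in\mathbb{Z}^d$. The associated flow $(T_t)_{t\in\mathbb{R}}$ is $T_t(\varphi)(x):=\varphi(X(t,x))$ for $\varphi\in C^0_\sharp(Y_d)$, $x\in\mathbb{R}^d$. A measure $\mu\in\mathscr{M}_p(Y_d)$ is invariant for the flow $T_t$ if for all $t\in\mathbb{R}$ and all $\psi\in C^0_\sharp(Y_d)$,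 $\int_{Y_d}\psi(X(t,y))\,d\mu(y)=\int_{Y_d}\psi(y)\,d\mu(y)$. *)

(* Defs.v *)
From HB Require Import structures.
From mathcomp Require Import all_boot all_order all_algebra.
From mathcomp Require Import all_classical all_reals all_analysis.
Set Implicit Arguments.
Unset Strict Implicit.
Unset Printing Implicit Defensive.
Import Order.TTheory GRing.Theory Num.Theory.
Import numFieldNormedType.Exports.
Local Open Scope classical_set_scope.
Local Open Scope ring_scope.

(* The carrier is 'rV[R]_d itself, with its Borel sigma-algebra. *)
Definition borelRV (R : realType) (d : nat) :=
  g_sigma_algebraType (@open 'rV[R]_d).

Definition shift_vec (R : realType) (d : nat) (k : 'rV[int]_d) : 'rV[R]_d :=
  map_mx intr k.

(* Fundamental domain [0,1)^d of R^d/Z^d. A Borel probability measure on the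
   torus is encoded as a Borel probability measure on R^d that gives mass 1 to
   this cube. *)
Definition unit_cube (R : realType) (d : nat) : set 'rV[R]_d :=
  [set y | forall i, 0 <= y ord0 i < 1].
Arguments unit_cube : clear implicits.

Definition torus_measure (R : realType) (d : nat)
    (mu : probability (borelRV R d) R) : Prop :=
  mu (unit_cube R d) = 1%E.

Definition periodic (R : realType) (d : nat) (f : 'rV[R]_d -> R) : Prop :=
  forall (x : 'rV[R]_d) (k : 'rV[int]_d), f (x + shift_vec R k) = f x.

Definition partial (R : realType) (d : nat) (i : 'I_d) (f : 'rV[R]_d -> R)
    : 'rV[R]_d -> R :=
  fun x => 'D_(delta_mx ord0 i) f x.

Fixpoint Ck (R : realType) (d k : nat) (f : 'rV[R]_d -> R) : Prop :=
  match k with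
  | 0 => continuous f
  | k'.+1 => continuous f /\
      forall i : 'I_d,
        (forall x, derivable f x (delta_mx ord0 i)) /\ Ck k' (partial i f)
  end.

Definition compactly_supported (R : realType) (d : nat) (f : 'rV[R]_d -> R)
    : Prop :=
  compact (closure [set x | f x != 0]).

Definition Ck_periodic (R : realType) (d k : nat) (f : 'rV[R]_d -> R) : Prop :=
  Ck k f /\ periodic f.

Definition Ck_compact (R : realType) (d k : nat) (f : 'rV[R]_d -> R) : Prop :=
  Ck k f /\ compactly_supported f.

Definition test_function (R : realType) (d : nat) (f : 'rV[R]_d -> R) : Prop :=
  (forall k, Ck k f) /\ compactly_supported f.

Definition C1_periodic_field (R : realType) (d : nat)
    (b : 'rV[R]_d -> 'rV[R]_d) : Prop :=
  forall i : 'I_d, Ck_periodic 1 (fun x => b x ord0 i).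

Definition grad (R : realType) (d : nat) (f : 'rV[R]_d -> R) (x : 'rV[R]_d)
    : 'rV[R]_d :=
  \row_i partial i f x.

Definition dot (R : realType) (d : nat) (u v : 'rV[R]_d) : R :=
  \sum_(i < d) u ord0 i * v ord0 i.

(* X t x is the value at time t of the solution starting from x. *)
Definition is_flow (R : realType) (d : nat) (b : 'rV[R]_d -> 'rV[R]_d)
    (X : R -> 'rV[R]_d -> 'rV[R]_d) : Prop :=
  forall x : 'rV[R]_d,
    X 0 x = x /\
    forall t : R, is_derive (t : R^o) (1 : R^o)
                    (fun s : R^o => X s x) (b (X t x)).

Definition flow_op (R : realType) (d : nat)
    (X : R -> 'rV[R]_d -> 'rV[R]_d) (t : R) (f : 'rV[R]_d -> R)
    : 'rV[R]_d -> R :=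
  fun x => f (X t x).

Definition invariant_measure (R : realType) (d : nat)
    (X : R -> 'rV[R]_d -> 'rV[R]_d) (mu : probability (borelRV R d) R) : Prop :=
  forall (t : R) (psi : 'rV[R]_d -> R), Ck_periodic 0 psi ->
    (\int[mu]_(y in unit_cube R d) (flow_op X t psi y)%:E =
     \int[mu]_(y in unit_cube R d) (psi y)%:E)%E.

(* For compactly supported f only finitely many terms are nonzero, so the
   finitely supported big sum is the full sum over Z^d. *)
Definition periodization (R : realType) (d : nat) (f : 'rV[R]_d -> R)
    (y : 'rV[R]_d) : R :=
  \sum_(k \in [set: 'rV[int]_d]) f (y + shift_vec R k).

(* On R^d the Borel measures finite on compact sets are the Radon measures. *)
Definition radon (R : realType) (d : nat)
    (nu : {measure set (borelRV R d) -> \bar R}) : Prop :=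
  forall K : set 'rV[R]_d, compact K -> (nu K < +oo)%E.

(* By the Riesz representation theorem these conditions determine mut. *)
Definition is_lift (R : realType) (d : nat)
    (mu : probability (borelRV R d) R)
    (mut : {measure set (borelRV R d) -> \bar R}) : Prop :=
  radon mut /\
  forall phi : 'rV[R]_d -> R, Ck_compact 0 phi ->
    (\int[mut]_x (phi x)%:E =
     \int[mu]_(y in unit_cube R d) (periodization phi y)%:E)%E.

(* div (nu b) = 0 in the sense of distributions. *)
Definition div_zero (R : realType) (d : nat)
    (nu : {measure set (borelRV R d) -> \bar R})
    (b : 'rV[R]_d -> 'rV[R]_d) : Prop :=
  forall phi : 'rV[R]_d -> R, test_function phi ->
    (\int[nu]_x (dot (b x) (grad phi x))%:E = 0)%E.

(* Main.v *)
Require Import Defs.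
From HB Require Import structures.
From mathcomp Require Import all_boot all_order all_algebra finmap.
From mathcomp Require Import all_classical all_reals all_analysis.
From mathcomp Require Import measurable_realfun ring lra zify.
Import Order.TTheory GRing.Theory Num.Theory.
Import numFieldNormedType.Exports.
Local Open Scope classical_set_scope.
Local Open Scope ring_scope.

(** The three conditions are linked by a cycle: invariance implies (b), (b)
    implies (a), (a) implies that b . grad (M u) has zero mean for every
    mollified Lipschitz periodic function M u, and this implies invariance.

    Invariance gives (b) by differentiating t |-> int psi(X(t,y)) dmu(y) at 0
    ([flow_mean_expansion]).  From (b) to (a): since b is periodic, periodizing
    b . grad phi gives b . grad (phi_#), and phi_# is an admissible psi
    ([periodization_dot_grad], [periodization_C1]).  From (a) to mollified
    functions: M u is itself a periodization, namely that of the test function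
    M (bump u), where the integer translates of bump add up to 1
    ([periodization_smooth_cell]).

    The last implication is the analytic heart.  For psi of class C^1 and
    u = psi o X_t, the derivative of the mean of u in t is the mean of
    g = (b . grad psi) o X_t, and it has to vanish.  If u were C^1, then g
    would be b . grad u.  Proving that the flow is differentiable in its
    initial point is avoided: Gronwall makes u Lipschitz, g is still the
    derivative of u along the flow, and b . grad (M u) is uniformly close to g.
    Indeed (M u)(x + s b(x)) - (M u)(x) averages u(y + s b(x)) - u(y) over
    points y near x; there y + s b(x) differs from X(s, y) by
    O(s |x - y| + s^2), so that this increment is s g(y) up to an error which
    the Lipschitz constants of u and b control ([smooth_flow_derivative]).
    Letting the scale of M tend to 0 shows that g has zero mean, hence that the
    mean of psi o X_t is constant, and C^1 functions are uniformly dense.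

    M must produce C^oo functions out of Lipschitz ones.  It is the infinite
    product of the averages T_n over boxes of side eps / 2^(n+1).  The partial
    derivative of an average is a difference quotient, which is a bounded
    operator commuting with translations; each derivative uses up one factor
    T_n and the remaining product still starts with averages, so that
    derivatives of all orders exist ([smoothed_partial]).  Every estimate on
    the way is uniform in the space variable, which makes it pass through
    translation-invariant operators and through the integral against mu. *)

Set Implicit Arguments.
Unset Strict Implicit.

(** * Differentiable functions of one real variable *)
Section real_line.
Context {R : realType}.
Implicit Types (f g v : R -> R) (a b s : R).

Lemma is_derive_continuous f s l : is_derive s 1 f l -> {for s, continuous f}.
Proof.
by move=> H; apply/differentiable_continuous/derivable1_diffP; exact: ex_derive.
Qed.

Lemma mvt_between f df a b :
  (forall s, Num.min a b <= s <= Num.max a b -> is_derive s 1 f (df s)) ->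
  exists2 c, Num.min a b <= c <= Num.max a b & f b - f a = df c * (b - a).
Proof.
wlog ab : a b / a <= b => [hw fdf|].
  have /orP[ab|ba] := le_total a b; first exact: hw.
  have [c cb E] := hw b a ba (ltac:(by rewrite minC maxC)).
  by exists c; rewrite 1?minC 1?maxC//; lra.
rewrite min_l// max_r// => fdf.
have [s||c] := @MVT_segment _ f df a b ab.
- by rewrite in_itv/= => /andP[? ?]; apply: fdf; apply/andP; split; exact: ltW.
- apply: continuous_in_subspaceT => s; rewrite inE/= in_itv/= => sab.
  exact: is_derive_continuous (fdf _ sab).
by rewrite in_itv/= => cab e; exists c.
Qed.

Lemma between_dist a b s : Num.min a b <= s <= Num.max a b -> `|s - a| <= `|b - a|.
Proof.
by have [ab|ba] := leP a b => /andP[? ?];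
  [rewrite !ger0_norm|rewrite !ler0_norm]; lra.
Qed.

Lemma is_derive_shift_arg f c s l :
  is_derive (c + s) 1 f l -> is_derive s 1 (fun r => f (c + r)) l.
Proof.
move=> fl; have g1 : is_derive s 1 (fun r : R => c + r) 1.
  by have := is_deriveD (is_derive_cst c s 1) (is_derive_id s 1); rewrite add0r.
by have := @is_derive1_comp R f (fun r => c + r) s l 1 fl g1; rewrite mulr1.
Qed.

(** Averages are computed from primitives, so that linearity, mean values and
    derivatives of averages all reduce to calculus of one variable.  The
    half-line beyond -1 leaves room to move the base point of an average a
    little to the left of 0. *)
Lemma primitive_exists v : continuous v ->
  exists V : R -> R, forall s, -1 < s -> is_derive s 1 V (v s).
Proof.
move=> vc; exists (fun y => \int[lebesgue_measure]_(t in `[(-1), y]) v t) => s s1.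
have iv : lebesgue_measure.-integrable `[(-1), s + 1] (EFin \o v).
  apply: continuous_compact_integrable; first exact: segment_compact.
  exact: continuous_subspaceT.
have ss1 : s < s + 1 by rewrite ltrDl.
have [V1 V2] := continuous_FTC1_closed ss1 iv s1 (vc s).
by apply: DeriveDef V1 _; rewrite -derive1E; exact: V2.
Qed.

Lemma Rintegral_primitive v V h : 0 < h -> continuous v ->
  (forall s, 0 <= s <= h -> is_derive s 1 V (v s)) ->
  \int[lebesgue_measure]_(s in `[0, h]) v s = V h - V 0.
Proof.
move=> h0 vc VD; rewrite /Rintegral (@continuous_FTC2 _ v V)//.
- exact: continuous_subspaceT.
- split.
  + move=> s; rewrite in_itv/= => /andP[? ?].
    by apply: ex_derive; apply: VD; apply/andP; split; exact: ltW.
  + apply: cvg_at_right_filter; apply: is_derive_continuous (VD 0 _).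
    by rewrite lexx ltW.
  + apply: cvg_at_left_filter; apply: is_derive_continuous (VD h _).
    by rewrite lexx ltW.
- move=> s; rewrite in_itv/= => /andP[? ?]; rewrite derive1E.
  by apply: derive_val; apply: VD; apply/andP; split; exact: ltW.
Qed.

End real_line.

(** * The normed space of row vectors *)
Section rowvec.
Context {R : realType} {d : nat}.
Local Notation V := 'rV[R]_d.
Implicit Types (x y z : V) (i : 'I_d).

Lemma rV_norm_le x B : 0 <= B -> (`|x| <= B) <-> (forall i, `|x ord0 i| <= B).
Proof.
move=> B0; rewrite [ `|x|]/Num.norm/= mx_normrE; split.
  by move/bigmax_leP => [_ H] i; exact: (H (ord0, i)).
by move=> H; apply/bigmax_leP; split=> // -[j i] _ /=; rewrite (ord1 j).
Qed.

Lemma coord_le_norm x i : `|x ord0 i| <= `|x|.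
Proof. exact: (rV_norm_le x (normr_ge0 x)).1. Qed.

Lemma continuous_at_rVP (u : V -> R) x : {for x, continuous u} <->
  forall e : R, 0 < e ->
    exists2 r : R, 0 < r & forall y, `|x - y| <= r -> `|u x - u y| <= e.
Proof.
rewrite /continuous_at; split.
  move/(@cvgrPdist_le _ R^o _ _ (nbhs_filter x)) => H e e0.
  have /nbhs_ballP[r/= r0 rH] := H e e0; exists (r / 2); first exact: divr_gt0.
  move=> y xy; apply: rH; rewrite -ball_normE/=; apply: le_lt_trans xy _.
  by rewrite ltr_pdivrMr// mulr_natr mulr2n ltrDl.
move=> H; apply/(@cvgrPdist_le _ R^o _ _ (nbhs_filter x)) => e e0.
have [r r0 rH] := H e e0; apply/nbhs_ballP; exists r => //= y.
by rewrite -ball_normE/= => /ltW; exact: rH.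
Qed.

Definition unitv i : V := delta_mx ord0 i.

Lemma norm_unitv s i : `|s *: unitv i| = `|s|.
Proof.
apply/eqP; rewrite eq_le; apply/andP; split.
  apply/rV_norm_le => // j; rewrite !mxE eqxx/=.
  by case: eqP => _; rewrite ?mulr1 ?mulr0 ?normr0.
by have := coord_le_norm (s *: unitv i) i; rewrite !mxE !eqxx mulr1.
Qed.

Lemma line_continuous (u : V -> R) x z : continuous u ->
  continuous (fun s : R => u (x + s *: z)).
Proof.
move=> uc s; apply: continuous_comp; last exact: uc.
by apply: cvgD; [exact: cvg_cst|apply: cvgZr_tmp; exact: cvg_id].
Qed.

Lemma is_derive_line (f : V -> R) x z s : derivable f (x + s *: z) z ->
  is_derive s 1 (fun r : R => f (x + r *: z)) ('D_z f (x + s *: z)).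
Proof.
have E : (fun h => h^-1 *: (f (x + (h *: (1:R) + s) *: z) - f (x + s *: z))) =
    (fun h : R => h^-1 *: (f (h *: z + (x + s *: z)) - f (x + s *: z))).
  apply/funext => h; congr (_ *: (f _ - _)).
  by rewrite [h *: 1]mulr1 scalerDl addrCA.
by move=> df; apply: DeriveDef; rewrite /derivable /derive E.
Qed.

End rowvec.
Arguments line_continuous {R d u} x z.

(** * Translation-invariant operators and averages along a segment *)
Section uniform.
Context {R : realType} {d : nat}.
Local Notation V := 'rV[R]_d.
Local Notation e_ i := (@unitv R d i).
Implicit Types (h s a C L : R) (u v f g : V -> R) (x y z : V) (i : 'I_d).
Implicit Types (T : (V -> R) -> V -> R).

Definition unif_cont u := forall e : R, 0 < e ->
  exists2 r : R, 0 < r & forall x y, `|x - y| <= r -> `|u x - u y| <= e.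

Definition lipschitz_with (L : R) u := forall x y, `|u x - u y| <= L * `|x - y|.

(** Differentiability in the i-th direction, uniformly in the base point.  The
    uniformity is what bounded translation-invariant operators preserve. *)
Definition unif_partial i f g := forall e : R, 0 < e ->
  exists2 r : R, 0 < r & forall (s : R) x, `|s| <= r ->
    `|f (x + s *: e_ i) - f x - s * g x| <= e * `|s|.

Lemma unif_cont_continuous u : unif_cont u -> continuous u.
Proof.
move=> uu x; apply/continuous_at_rVP => e e0; have [r r0 ur] := uu e e0.
by exists r => // y; exact: ur.
Qed.

Lemma lipschitz_unif_cont L u : lipschitz_with L u -> unif_cont u.
Proof.
move=> uL e e0; have L1 : 0 < 1 + `|L| by rewrite ltr_pwDl.
exists (e / (1 + `|L|)); first exact: divr_gt0.
move=> x y; rewrite ler_pdivlMr// => H; apply: le_trans (uL x y) _.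
apply: le_trans H; rewrite mulrC ler_wpM2l//.
by rewrite (le_trans (ler_norm L))// lerDr.
Qed.

Lemma unif_cont_lin a u v : unif_cont u -> unif_cont v ->
  unif_cont (fun x => a * u x + v x).
Proof.
move=> uu uv e e0; have a1 : 0 < 1 + `|a| by rewrite ltr_pwDl.
have [r r0 ur] := uu (e / 2 / (1 + `|a|)) (divr_gt0 (divr_gt0 e0 (ltr0n _ 2)) a1).
have [q q0 vq] := uv (e / 2) (divr_gt0 e0 (ltr0n _ 2)).
exists (Num.min r q); first by rewrite lt_min r0.
move=> x y; rewrite le_min => /andP[/ur Hu /vq Hv].
have -> : a * u x + v x - (a * u y + v y) = a * (u x - u y) + (v x - v y) by ring.
apply: le_trans (ler_normD _ _) _; rewrite [leRHS](splitr e) lerD// normrM.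
apply: le_trans (_ : (1 + `|a|) * (e / 2 / (1 + `|a|)) <= _).
  by apply: ler_pM => //; rewrite lerDr.
by rewrite mulrC divfK ?gt_eqF.
Qed.

Lemma subr_shift x y z : (x + z) - (y + z) = x - y.
Proof. by rewrite opprD addrACA subrr addr0. Qed.

Lemma unif_cont_shift z u : unif_cont u -> unif_cont (fun x => u (x + z)).
Proof.
move=> uu e e0; have [r r0 ur] := uu e e0; exists r => // x y xy.
by apply: ur; rewrite subr_shift.
Qed.

Lemma lipschitz_shift L z u : lipschitz_with L u -> lipschitz_with L (fun x => u (x + z)).
Proof. by move=> uL x y; have := uL (x + z) (y + z); rewrite subr_shift. Qed.

Lemma unif_partial_derive i f g x : unif_partial i f g ->
  is_derive x (e_ i) f (g x).
Proof.
move=> fg; suff H : (h^-1 *: (f (h *: e_ i + x) - f x)) @[h --> 0^'] --> g x.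
  apply: DeriveDef; first by apply/cvg_ex; exists (g x).
  exact: cvg_lim H.
apply/cvgrPdist_le => e e0; have [r r0 fr] := fg e e0.
near=> h.
have h0 : h != 0 by near: h; exact: nbhs_dnbhs_neq.
have hr : `|h| <= r by near: h; exact: dnbhs0_le.
have := fr h x hr; rewrite [h *: _ + x]addrC; set D := f _ - f x => H.
rewrite -(ler_pM2r (_ : 0 < `|h|)) ?normr_gt0//; apply: le_trans H.
rewrite -normrM -normrN [h^-1 *: D]/(h^-1 * D) le_eqVlt; apply/orP; left.
by apply/eqP; congr `|_|; rewrite mulrBl mulrAC mulVf// mul1r opprB [g x * h]mulrC.
Unshelve. all: by end_near. Qed.

(** The operators that commute with translations and are bounded by C for the
    sup norm.  Averages and difference quotients are such operators; they pass
    moduli of continuity and uniform derivatives on to their values. *)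
Record transl_op (C : R) T : Prop := TranslOp {
  transl_op_ge0 : 0 <= C ;
  transl_op_lin : forall a u v, unif_cont u -> unif_cont v ->
    forall x, T (fun y => a * u y + v y) x = a * T u x + T v x ;
  transl_op_shift : forall u z x, T (fun y => u (y + z)) x = T u (x + z) ;
  transl_op_bound : forall u B, unif_cont u -> (forall x, `|u x| <= B) ->
    forall x, `|T u x| <= C * B }.

Lemma transl_op_sub C T u v x : transl_op C T -> unif_cont u -> unif_cont v ->
  T (fun y => u y - v y) x = T u x - T v x.
Proof.
move=> TT uu uv; have -> : (fun y => u y - v y) = (fun y => - 1 * v y + u y).
  by apply/funext => y; ring.
by rewrite (transl_op_lin TT)//; ring.
Qed.

Lemma unif_cont_sub u v : unif_cont u -> unif_cont v ->
  unif_cont (fun x => u x - v x).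
Proof.
move=> uu uv; have -> : (fun y => u y - v y) = (fun y => - 1 * v y + u y).
  by apply/funext => y; ring.
exact: unif_cont_lin.
Qed.

Lemma transl_op_dist C T u v B x : transl_op C T -> unif_cont u -> unif_cont v ->
  (forall y, `|u y - v y| <= B) -> `|T u x - T v x| <= C * B.
Proof.
move=> TT uu uv uvB; rewrite -(transl_op_sub _ TT)//.
by apply: (transl_op_bound TT) => //; exact: unif_cont_sub.
Qed.

(** Commuting with translations turns the sup-norm bound into a bound on
    increments. *)
Lemma transl_op_shift_dist C T u B x y : transl_op C T -> unif_cont u ->
  (forall z, `|u (z + x) - u (z + y)| <= B) -> `|T u x - T u y| <= C * B.
Proof.
move=> TT uu uB; have := @transl_op_dist C T _ _ B 0 TT
  (unif_cont_shift x uu) (unif_cont_shift y uu) uB.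
by rewrite !(transl_op_shift TT) !add0r.
Qed.

Lemma transl_op_unif_cont C T u : transl_op C T -> unif_cont u -> unif_cont (T u).
Proof.
move=> TT uu e e0; have C1 : 0 < 1 + C by rewrite ltr_pwDl ?(transl_op_ge0 TT).
have [r r0 ur] := uu (e / (1 + C)) (divr_gt0 e0 C1); exists r => // x y xy.
apply: le_trans (transl_op_shift_dist TT uu (B := e / (1 + C)) _) _.
  by move=> z; apply: ur; rewrite ![z + _]addrC subr_shift.
rewrite mulrA ler_pdivrMr// mulrC ler_wpM2l// ?ltW//; lra.
Qed.

Lemma transl_op_lipschitz C T L u : transl_op C T -> lipschitz_with L u ->
  lipschitz_with (C * L) (T u).
Proof.
move=> TT uL x y; rewrite -mulrA.
apply: transl_op_shift_dist TT (lipschitz_unif_cont uL) _ => z.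
by have := uL (z + x) (z + y); rewrite ![z + _]addrC subr_shift.
Qed.

(** The first-order remainder of T f is T applied to the remainder of f, which
    is uniformly small. *)
Lemma transl_op_unif_partial C T i f g : transl_op C T ->
  unif_cont f -> unif_cont g -> unif_partial i f g -> unif_partial i (T f) (T g).
Proof.
move=> TT uf ug fg e e0; have C1 : 0 < 1 + C by rewrite ltr_pwDl ?(transl_op_ge0 TT).
have [r r0 fr] := fg (e / (1 + C)) (divr_gt0 e0 C1); exists r => // s x sr.
have -> : T f (x + s *: e_ i) - T f x - s * T g x =
    T (fun y => - s * g y + (f (y + s *: e_ i) - f y)) x.
  rewrite (transl_op_lin TT)//; last by apply: unif_cont_sub => //; exact: unif_cont_shift.
  rewrite (transl_op_sub _ TT)// ?(transl_op_shift TT); first by ring.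
  exact: unif_cont_shift.
apply: le_trans (transl_op_bound TT (B := e / (1 + C) * `|s|) _ _ x) _.
- apply: unif_cont_lin => //; apply: unif_cont_sub => //; exact: unif_cont_shift.
- by move=> y; have := fr s y sr; rewrite mulNr [X in _ -> `|X| <= _]addrC.
- rewrite mulrA ler_wpM2r// mulrA ler_pdivrMr// mulrC ler_wpM2l// ?ltW//; lra.
Qed.

Lemma transl_op_id : transl_op 1 id.
Proof. by split => //= u B _ uB x; rewrite mul1r. Qed.

Lemma transl_op_comp C C' T T' : transl_op C T -> transl_op C' T' ->
  transl_op (C * C') (T \o T').
Proof.
move=> TT TT'; have uc u : unif_cont u -> unif_cont (T' u).
  exact: transl_op_unif_cont TT'.
split=> /=.
- by rewrite mulr_ge0 ?(transl_op_ge0 TT) ?(transl_op_ge0 TT').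
- move=> a u v uu uv x; rewrite -(transl_op_lin TT); [|exact: uc..].
  by congr (T _ x); apply/funext => y; rewrite (transl_op_lin TT').
- move=> u z x; rewrite -(transl_op_shift TT).
  by congr (T _ x); apply/funext => y; rewrite (transl_op_shift TT').
- move=> u B uu uB x; rewrite -mulrA; apply: (transl_op_bound TT); first exact: uc.
  exact: (transl_op_bound TT').
Qed.

Definition diff_quot i h u x := h^-1 * (u (x + h *: e_ i) - u x).

Lemma transl_op_diff_quot i h : 0 < h -> transl_op (h^-1 * 2) (diff_quot i h).
Proof.
move=> h0; split; rewrite /diff_quot.
- by rewrite mulr_ge0// ltW// invr_gt0.
- by move=> a u v _ _ x; ring.
- by move=> u z x; rewrite addrAC.
- move=> u B _ uB x; rewrite normrM gtr0_norm ?invr_gt0// -mulrA ler_pM2l ?invr_gt0//.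
  by rewrite (le_trans (ler_normB _ _))// mulr_natl mulr2n lerD.
Qed.

Definition avg i h u x :=
  h^-1 * \int[lebesgue_measure]_(s in `[0, h]) u (x + s *: e_ i).

Lemma avg_primitive i h u x (W : R -> R) : 0 < h -> continuous u ->
  (forall s, 0 <= s <= h -> is_derive s 1 W (u (x + s *: e_ i))) ->
  avg i h u x = h^-1 * (W h - W 0).
Proof.
by move=> h0 uc uW; rewrite /avg (Rintegral_primitive h0 (line_continuous x (e_ i) uc) uW).
Qed.

Lemma avg_mean i h u x : 0 < h -> continuous u ->
  exists2 s : R, 0 <= s <= h & avg i h u x = u (x + s *: e_ i).
Proof.
move=> h0 uc; have [W WD] := primitive_exists (line_continuous x (e_ i) uc).
have WD' s : 0 <= s <= h -> is_derive s 1 W (u (x + s *: e_ i)).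
  by move=> /andP[s0 _]; apply: WD; lra.
have [||s] := @MVT_segment R W (fun s => u (x + s *: e_ i)) 0 h (ltW h0).
- by move=> s; rewrite in_itv/= => /andP[s0 sh]; apply: WD'; rewrite !ltW.
- apply: continuous_in_subspaceT => s; rewrite inE/= in_itv/= => sh.
  exact: is_derive_continuous (WD' _ sh).
rewrite in_itv/= => sh WE; exists s => //.
by rewrite (avg_primitive h0 uc WD') WE subr0 mulrCA mulVf ?mulr1 ?gt_eqF.
Qed.

Lemma transl_op_avg i h : 0 < h -> transl_op 1 (avg i h).
Proof.
move=> h0; split => //.
- move=> a u v uu uv x.
  have [uc vc] := (unif_cont_continuous uu, unif_cont_continuous uv).
  have [U UD] := primitive_exists (line_continuous x (e_ i) uc).
  have [W WD] := primitive_exists (line_continuous x (e_ i) vc).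
  have -> : avg i h u x = h^-1 * (U h - U 0).
    by apply: avg_primitive => // s /andP[s0 _]; apply: UD; lra.
  have -> : avg i h v x = h^-1 * (W h - W 0).
    by apply: avg_primitive => // s /andP[s0 _]; apply: WD; lra.
  suff -> : avg i h (fun y => a * u y + v y) x =
      h^-1 * ((a * U h + W h) - (a * U 0 + W 0)) by ring.
  apply: (@avg_primitive i h _ x (fun s => a * U s + W s)) => //.
    exact/unif_cont_continuous/unif_cont_lin.
  move=> s /andP[s0 _]; have s1 : -1 < s by lra.
  exact: (is_deriveD (is_deriveZ a (UD s s1)) (WD s s1)).
- move=> u z x; rewrite /avg; congr (_ * _); congr (fine _).
  by apply: eq_integral => s _; rewrite addrAC.
- move=> u B /unif_cont_continuous uc uB x; rewrite mul1r.
  by have [s _ ->] := avg_mean i x h0 uc.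
Qed.

(** If W is a primitive of s |-> u(x + s e_i), then s |-> avg u (x + s e_i) is
    (W(s + h) - W(s)) / h, whose derivative is a difference quotient of u. *)
Lemma avg_unif_partial i h u : 0 < h -> unif_cont u ->
  unif_partial i (avg i h u) (diff_quot i h u).
Proof.
move=> h0 uu e e0; have uc := unif_cont_continuous uu.
have eh : 0 < e * h / 2 by rewrite !mulr_gt0// invr_gt0.
have [r r0 ur] := uu _ eh.
exists (Num.min r (1 / 2)); first by rewrite lt_min r0/=; lra.
move=> s x; rewrite le_min => /andP[sr s1].
have [s1a s1b] : - s <= 1 / 2 /\ s <= 1 / 2.
  by move: s1; rewrite ler_norml => /andP[? ?]; split; lra.
(* one primitive serves the averages at x and at x + s e_i *)
have [W WD] := primitive_exists (line_continuous x (e_ i) uc).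
have -> : avg i h u x = h^-1 * (W h - W 0).
  by apply: avg_primitive => // q /andP[q0 _]; apply: WD; lra.
have -> : avg i h u (x + s *: e_ i) = h^-1 * (W (s + h) - W s).
  have := @avg_primitive i h u (x + s *: e_ i) (fun q => W (s + q)).
  rewrite addr0; apply=> //.
  move=> q /andP[q0 _]; rewrite -addrA -scalerDl.
  have sq : - 1 < s + q by lra.
  exact: is_derive_shift_arg (WD _ sq).
pose F (q : R) := W (q + h) - W q.
have [q sq|q /between_dist sq FE] := @mvt_between R F
    (fun q => u (x + (q + h) *: e_ i) - u (x + q *: e_ i)) 0 s.
  have q1 : - 1 < q by move: sq; have [?|?] := leP 0 s => /andP[? ?]; lra.
  apply: is_deriveB; last exact: WD.
  rewrite /F; under eq_fun do rewrite addrC; rewrite [q + h]addrC.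
  by apply: is_derive_shift_arg; apply: WD; lra.
rewrite /diff_quot; set D := (X in `|X|).
have -> : D = h^-1 * (F s - F 0 - s * (u (x + h *: e_ i) - u x)).
  by rewrite /D /F add0r; field; rewrite gt_eqF.
rewrite FE normrM gtr0_norm ?invr_gt0// subr0 mulrC [_ * s]mulrC -mulrBr normrM.
rewrite ler_pdivrMr// [leRHS]mulrAC [leRHS]mulrC ler_wpM2l//.
have qr : `|q| <= r by rewrite !subr0 in sq; exact: le_trans sr.
rewrite scalerDl addrA; set a := u _; set b := u _; set c := u _.
have -> : a - b - (c - u x) = (a - c) - (b - u x) by ring.
rewrite (le_trans (ler_normB _ _))// [leRHS](splitr (e * h)) lerD//.
- by apply: ur; rewrite subr_shift addrAC subrr add0r norm_unitv.
- by apply: ur; rewrite addrAC subrr add0r norm_unitv.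
Qed.

End uniform.

(** * The mollifier: an infinite product of box averages *)
Section smoothing.
Context {R : realType} {d : nat}.
Local Notation V := 'rV[R]_d.
Local Notation e_ i := (@unitv R d i).
Implicit Types (h s a C L : R) (u v f g : V -> R) (x y z : V) (i : 'I_d).
Implicit Types (T : (V -> R) -> V -> R).

Definition avgs (l : seq 'I_d) h u : V -> R := foldr (fun i => avg i h) u l.

Lemma transl_op_avgs l h : 0 < h -> transl_op 1 (avgs l h).
Proof.
move=> h0; elim: l => [|i l IH]; first exact: transl_op_id.
by rewrite -[X in transl_op X](mulr1 1); exact: transl_op_comp (transl_op_avg i h0) IH.
Qed.

Lemma avgs_unif_cont l h u : 0 < h -> unif_cont u -> unif_cont (avgs l h u).
Proof. by move=> h0; apply: transl_op_unif_cont (transl_op_avgs l h0). Qed.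

(** Only the average in direction i is differentiated; the averages applied
    after it are carried along by [transl_op_unif_partial]. *)
Lemma avgs_unif_partial l h u i : 0 < h -> unif_cont u -> i \in l ->
  exists C T, transl_op C T /\ unif_partial i (avgs l h u) (T u).
Proof.
move=> h0 uu; elim: l => //= j l IH; rewrite inE => /predU1P[<-{j}|/IH[C [T [TT Tu]]]].
  exists (h^-1 * 2 * 1), (diff_quot i h \o avgs l h); split.
    exact: transl_op_comp (transl_op_diff_quot i h0) (transl_op_avgs l h0).
  by apply: avg_unif_partial => //; exact: avgs_unif_cont.
exists (1 * C), (avg j h \o T); split; first exact: transl_op_comp (transl_op_avg j h0) TT.
apply: transl_op_unif_partial (transl_op_avg j h0) _ _ Tu.
  exact: avgs_unif_cont.
exact: transl_op_unif_cont TT uu.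
Qed.

(** Each average moves the point by at most h; counting the moves gives a
    cruder radius than the sup norm would allow, but it suffices. *)
Lemma avgs_local l h u c B x : 0 < h -> unif_cont u ->
  (forall z, `|z| <= (size l)%:R * h -> `|u (x + z) - c| <= B) ->
  `|avgs l h u x - c| <= B.
Proof.
move=> h0 uu; elim: l x => [|i l IH] x uB /=.
  by rewrite -[x]addr0; apply: uB; rewrite normr0 mul0r.
have [s /andP[s0 sh] ->] := avg_mean i x h0 (unif_cont_continuous (avgs_unif_cont l h0 uu)).
apply: IH => z zl; rewrite -addrA; apply: uB.
rewrite (le_trans (ler_normD _ _))// norm_unitv ger0_norm//.
by rewrite /= -natr1 mulrDl mul1r addrC lerD.
Qed.

Definition box_avg := avgs (enum 'I_d).

Lemma transl_op_box h : 0 < h -> transl_op 1 (box_avg h).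
Proof. exact: transl_op_avgs. Qed.

Lemma box_local h u c B x : 0 < h -> unif_cont u ->
  (forall z, `|z| <= d%:R * h -> `|u (x + z) - c| <= B) ->
  `|box_avg h u x - c| <= B.
Proof. by move=> h0 uu H; apply: avgs_local => // z; rewrite size_enum_ord; exact: H. Qed.

Lemma box_unif_partial h u i : 0 < h -> unif_cont u ->
  exists C T, transl_op C T /\ unif_partial i (box_avg h u) (T u).
Proof. by move=> h0 uu; apply: avgs_unif_partial => //; rewrite mem_enum. Qed.

Section infinite_product.
Variable eps : R.
Hypothesis eps0 : 0 < eps.

Let h_ n := eps / 2 ^+ n.+1.

Lemma step_gt0 n : 0 < h_ n.
Proof. by rewrite divr_gt0// exprn_gt0. Qed.

(** The product T_n T_(n+1) ... T_(n+N-1), where T_n averages over boxes of side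
    h_ n; the smallest boxes act first, so that raising N refines the innermost
    factor. *)
Fixpoint box_prod (n N : nat) u : V -> R :=
  if N is N'.+1 then box_avg (h_ n) (box_prod n.+1 N' u) else u.

Lemma transl_op_box_prod n N : transl_op 1 (box_prod n N).
Proof.
elim: N n => [|N IH] n; first exact: transl_op_id.
rewrite -[X in transl_op X](mulr1 1).
exact: transl_op_comp (transl_op_box (step_gt0 n)) (IH n.+1).
Qed.

Lemma box_prod_unif_cont n N u : unif_cont u -> unif_cont (box_prod n N u).
Proof. exact: transl_op_unif_cont (transl_op_box_prod n N). Qed.

(* the radii h_ n, ..., h_ (n + N - 1) add up to less than eps / 2 ^+ n *)
Lemma box_prod_local n N u c B x : unif_cont u ->
  (forall z, `|z| <= d%:R * (eps / 2 ^+ n) -> `|u (x + z) - c| <= B) ->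
  `|box_prod n N u x - c| <= B.
Proof.
move=> uu; elim: N n x => [|N IH] n x uB /=.
  rewrite -[x]addr0; apply: uB; rewrite normr0 mulr_ge0 ?ler0n//.
  by rewrite divr_ge0 ?exprn_ge0// ltW.
apply: box_local; [exact: step_gt0|exact: box_prod_unif_cont|move=> z zh].
apply: IH => w wh; rewrite -addrA; apply: uB; rewrite (le_trans (ler_normD _ _))//.
apply: le_trans (lerD zh wh) _; rewrite -mulrDr ler_wpM2l ?ler0n// /h_ exprS.
have : 2 ^+ n != 0 :> R by rewrite expf_neq0.
by move=> n0; rewrite le_eqVlt; apply/orP; left; apply/eqP; field.
Qed.

(** Bound for the effect of all factors from T_n on: the distance that they can
    move a point, times the Lipschitz constant. *)
Definition rate L N := d%:R * L * eps / 2 ^+ N.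

Lemma rate_ge0 L N : 0 <= L -> 0 <= rate L N.
Proof. by move=> L0; rewrite /rate divr_ge0 ?exprn_ge0// !mulr_ge0 ?ler0n// ltW. Qed.

Lemma rate_step L n : rate L n - rate L n.+1 = L * (d%:R * h_ n).
Proof.
rewrite /rate /h_ exprS; have n0 : 2 ^+ n != 0 :> R by rewrite expf_neq0.
by field.
Qed.

Lemma box_prod_step n N L u x : 0 <= L -> lipschitz_with L u ->
  `|box_prod n N.+1 u x - box_prod n N u x| <= rate L (n + N) - rate L (n + N).+1.
Proof.
move=> L0 uL; have uu := lipschitz_unif_cont uL.
elim: N n x => [|N IH] n x.
  rewrite addn0 rate_step; apply: box_local => //; first exact: step_gt0.
  move=> z zh; apply: le_trans (uL _ _) _; rewrite addrAC subrr add0r.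
  exact: ler_wpM2l.
rewrite -[leRHS]mul1r -addSnnS /=.
exact: (transl_op_dist x (transl_op_box (step_gt0 n))
  (box_prod_unif_cont _ N.+1 uu) (box_prod_unif_cont _ N uu) (IH n.+1)).
Qed.

Lemma box_prod_dist n N k L u x : 0 <= L -> lipschitz_with L u ->
  `|box_prod n (N + k) u x - box_prod n N u x| <= rate L (n + N).
Proof.
move=> L0 uL; apply: le_trans (_ : rate L (n + N) - rate L (n + N + k) <= _); last first.
  by rewrite lerBlDr lerDl rate_ge0.
elim: k => [|k IH]; first by rewrite !addn0 !subrr normr0.
rewrite -(subrKA (box_prod n (N + k) u x)) (le_trans (ler_normD _ _))//.
rewrite -[leRHS](subrKA (rate L (n + N + k))) addrC lerD//.
by rewrite !addnS -addnA; exact: box_prod_step.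
Qed.

(** Starting the product at an arbitrary n is what makes differentiation
    possible: T_n can be split off and the rest is of the same kind. *)
Definition smooth n u x : R := limn (fun N => box_prod n N u x).

Lemma rate_cvg L n : rate L (n + N) @[N --> \oo] --> 0.
Proof.
rewrite /rate -(mulr0 (d%:R * L * eps)); apply: cvgMl_tmp.
rewrite (_ : (fun _ => _) = (fun N => (2^-1 ^+ n) * (2^-1 ^+ N))); last first.
  by apply/funext => N; rewrite -exprD exprVn.
rewrite -(mulr0 (2^-1 ^+ n)); apply: cvgMl_tmp; apply: cvg_expr.
by rewrite ger0_norm ?invr_ge0// invf_lt1// ltr1n.
Qed.

Lemma box_prod_cvg n L u x : 0 <= L -> lipschitz_with L u ->
  box_prod n N u x @[N --> \oo] --> smooth n u x.
Proof.
move=> L0 uL; suff : cvg (box_prod n N u x @[N --> \oo]) by [].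
apply/cauchy_cvgP; apply: cauchy_exP => e e0.
have /cvgrPdist_lt/(_ e e0)[N _ /(_ N (leqnn N))] := rate_cvg L n.
rewrite sub0r normrN ger0_norm ?rate_ge0// => rN; exists (box_prod n N u x); exists N => //= k Nk.
by rewrite -ball_normE/= distrC (le_lt_trans _ rN)// -(subnKC Nk) box_prod_dist.
Qed.

Lemma smooth_dist n N L u x : 0 <= L -> lipschitz_with L u ->
  `|smooth n u x - box_prod n N u x| <= rate L (n + N).
Proof.
move=> L0 uL.
have H : `|box_prod n (k + N) u x - box_prod n N u x| @[k --> \oo] -->
    `|smooth n u x - box_prod n N u x|.
  apply: cvg_norm; apply: cvgB; last exact: cvg_cst.
  have := @box_prod_cvg n L u x L0 uL; rewrite -(cvg_shiftn N); exact.
rewrite -(cvg_lim _ H)//; apply: limr_le; first by apply/cvg_ex; eexists; exact: H.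
by apply: nearW => k; rewrite addnC; exact: box_prod_dist.
Qed.

(** Passage to the limit: an inequality that the finite products satisfy up to
    the tail bound holds for the infinite product. *)
Lemma le_rate L n c a b : (forall N, a <= b + c * rate L (n + N)) -> a <= b.
Proof.
move=> H; have C : b + c * rate L (n + N) @[N --> \oo] --> b.
  rewrite -[X in _ --> X]addr0 -(mulr0 c).
  by apply: cvgD; [exact: cvg_cst|apply: cvgMl_tmp; exact: rate_cvg].
rewrite -(cvg_lim _ C)//; apply: limr_ge; first by apply/cvg_ex; eexists; exact: C.
exact: nearW.
Qed.

Lemma smooth_lipschitz n L u : 0 <= L -> lipschitz_with L u ->
  lipschitz_with L (smooth n u).
Proof.
move=> L0 uL x y; apply: (@le_rate L n 2) => N.
have -> : smooth n u x - smooth n u y = box_prod n N u x - box_prod n N u y +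
   ((smooth n u x - box_prod n N u x) - (smooth n u y - box_prod n N u y)) by ring.
apply: le_trans (ler_normD _ _) (lerD _ _).
  by rewrite -[L]mul1r; exact: transl_op_lipschitz (transl_op_box_prod n N) uL _ _.
apply: le_trans (ler_normB _ _) _; rewrite mulr_natl mulr2n.
by apply: lerD; exact: smooth_dist.
Qed.

Lemma smooth_unif_cont n L u : 0 <= L -> lipschitz_with L u -> unif_cont (smooth n u).
Proof. by move=> L0 uL; apply: lipschitz_unif_cont (smooth_lipschitz n L0 uL). Qed.

Lemma smooth_rec n L u : 0 <= L -> lipschitz_with L u ->
  smooth n u = box_avg (h_ n) (smooth n.+1 u).
Proof.
move=> L0 uL; apply/funext => x; apply/eqP; rewrite -subr_eq0 -normr_le0.
have uu := lipschitz_unif_cont uL.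
apply: (@le_rate L n.+1 2) => N; rewrite add0r -(subrKA (box_prod n N.+1 u x)).
apply: le_trans (ler_normD _ _) _; rewrite mulr_natl mulr2n addSnnS; apply: lerD.
  exact: smooth_dist.
rewrite -[leRHS]mul1r -addSnnS /=.
apply: transl_op_dist (transl_op_box (step_gt0 n)) (box_prod_unif_cont _ N uu) _ _.
  exact: smooth_unif_cont L0 uL.
by move=> y; rewrite distrC; exact: smooth_dist.
Qed.

Lemma smooth_local n L u c B x : 0 <= L -> lipschitz_with L u ->
  (forall z, `|z| <= d%:R * (eps / 2 ^+ n) -> `|u (x + z) - c| <= B) ->
  `|smooth n u x - c| <= B.
Proof.
move=> L0 uL uB; apply: (@le_rate L n 1) => N.
rewrite mul1r -(subrKA (box_prod n N u x)) addrC.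
apply: le_trans (ler_normD _ _) (lerD _ _); last exact: smooth_dist.
by apply: box_prod_local uB; exact: lipschitz_unif_cont uL.
Qed.

Lemma smooth_shift n u z x : smooth n (fun y => u (y + z)) x = smooth n u (x + z).
Proof.
rewrite /smooth; suff -> : (fun N => box_prod n N (fun y => u (y + z)) x) =
  (fun N => box_prod n N u (x + z)) by [].
by apply/funext => N; rewrite (transl_op_shift (transl_op_box_prod n N)).
Qed.

Lemma smooth_lin n a L L' u v x : 0 <= L -> lipschitz_with L u ->
  0 <= L' -> lipschitz_with L' v ->
  smooth n (fun y => a * u y + v y) x = a * smooth n u x + smooth n v x.
Proof.
move=> L0 uL L'0 vL'; apply: cvg_lim => //.
have -> : (fun N => box_prod n N (fun y => a * u y + v y) x) =
          (fun N => a * box_prod n N u x + box_prod n N v x).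
  apply/funext => N; apply: (transl_op_lin (transl_op_box_prod n N)).
    exact: lipschitz_unif_cont uL.
  exact: lipschitz_unif_cont vL'.
by apply: cvgD; [apply: cvgMl_tmp; exact: box_prod_cvg L0 uL|exact: box_prod_cvg L'0 vL'].
Qed.

Lemma smooth0 n x : smooth n (fun=> 0) x = 0.
Proof.
have L0 : lipschitz_with 0 ((fun=> 0) : V -> R) by move=> y z; rewrite mul0r subrr normr0.
apply/eqP; rewrite -normr_le0 -[smooth _ _ _]subr0.
by apply: smooth_local (lexx 0) L0 _ => z _; rewrite subrr normr0.
Qed.

Lemma lipschitz_sum (I : Type) (r : seq I) (F : I -> V -> R) L :
  (forall k, lipschitz_with L (F k)) ->
  lipschitz_with ((size r)%:R * L) (fun y => \sum_(k <- r) F k y).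
Proof.
move=> FL x y; rewrite -sumrB -mulrA mulr_natl; elim: r => [|k r IH].
  by rewrite big_nil normr0 mulr0n.
rewrite big_cons/= mulrS (le_trans (ler_normD _ _))// lerD//; exact: FL.
Qed.

Lemma smooth_sum (I : Type) (r : seq I) (F : I -> V -> R) n L x : 0 <= L ->
  (forall k, lipschitz_with L (F k)) ->
  smooth n (fun y => \sum_(k <- r) F k y) x = \sum_(k <- r) smooth n (F k) x.
Proof.
move=> L0 FL; elim: r => [|k r IH].
  by rewrite big_nil -[RHS](smooth0 n x); congr smooth; apply/funext => y; rewrite big_nil.
rewrite big_cons -IH -[smooth n (F k) x]mul1r -(@smooth_lin n 1 L ((size r)%:R * L))//.
- by congr smooth; apply/funext => y; rewrite big_cons mul1r.
- by rewrite mulr_ge0 ?ler0n.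
- exact: lipschitz_sum.
Qed.

Section smooth_class.
Variables (L : R) (u : V -> R).
Hypotheses (L0 : 0 <= L) (uL : lipschitz_with L u).

(** A class stable under partial derivatives: bounded translation-invariant
    operators applied to some tail of the infinite product. *)
Definition smoothed f := exists n C T, transl_op C T /\ f = T (smooth n u).

Lemma smoothed_unif_cont f : smoothed f -> unif_cont f.
Proof.
move=> [n [C [T [TT ->]]]]; apply: transl_op_unif_cont TT _.
exact: smooth_unif_cont L0 uL.
Qed.

(** Split T_n off the tail: its derivative in direction i is a bounded operator
    T' applied to the next tail, and T commutes with differentiation. *)
Lemma smoothed_partial f i : smoothed f -> exists2 g, smoothed g & unif_partial i f g.
Proof.
move=> [n [C [T [TT ->]]]]; rewrite (smooth_rec n L0 uL).
have uu := smooth_unif_cont n.+1 L0 uL.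
have [C' [T' [TT' H]]] := box_unif_partial i (step_gt0 n) uu.
exists ((T \o T') (smooth n.+1 u)).
  by exists n.+1, (C * C'), (T \o T'); split => //; exact: transl_op_comp TT TT'.
apply: transl_op_unif_partial TT _ _ H; last exact: transl_op_unif_cont TT' _.
exact: transl_op_unif_cont (transl_op_box (step_gt0 n)) _.
Qed.

Lemma smoothed_Ck f k : smoothed f -> Ck k f.
Proof.
elim: k f => [|k IH] f sf /=; first exact/unif_cont_continuous/smoothed_unif_cont.
split=> [|i]; first exact/unif_cont_continuous/smoothed_unif_cont.
have [g sg fg] := smoothed_partial i sf; split=> [x|].
  by have [] := unif_partial_derive x fg.
suff -> : partial i f = g by exact: IH.
by apply/funext => x; have [_ dfx] := unif_partial_derive x fg; exact: dfx.
Qed.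

Lemma smooth_Ck n k : Ck k (smooth n u).
Proof. by apply: smoothed_Ck; exists n, 1, id; split => //; exact: transl_op_id. Qed.

Lemma smooth_partial_unif_cont n i : unif_cont (partial i (smooth n u)).
Proof.
have [|g sg fg] := @smoothed_partial (smooth n u) i.
  by exists n, 1, id; split => //; exact: transl_op_id.
suff -> : partial i (smooth n u) = g by exact: smoothed_unif_cont.
by apply/funext => x; have [_ dfx] := unif_partial_derive x fg; exact: dfx.
Qed.

End smooth_class.

End infinite_product.
End smoothing.

(** * Functions with continuous partial derivatives *)
Section C1_functions.
Context {R : realType} {d : nat}.
Local Notation V := 'rV[R]_d.
Local Notation e_ i := (@unitv R d i).
Implicit Types (h s a C L : R) (u v f g : V -> R) (x y z : V) (i : 'I_d).

Definition partially_derivable f := forall i x, derivable f x (e_ i).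

(** Move from x to y one coordinate at a time and apply the mean value theorem
    to each move.  This replaces the chain rule everywhere below: Lipschitz
    bounds and first-order expansions are read off from it. *)
Lemma C1_increment f x y : partially_derivable f ->
  exists xi : 'I_d -> V, (forall i, `|xi i - x| <= `|y - x|) /\
    f y - f x = \sum_i partial i f (xi i) * (y - x) ord0 i.
Proof.
move=> fD; pose w (n : nat) : V := \row_j (if (j < n)%N then y ord0 j else x ord0 j).
(* w n has its first n coordinates from y and the others from x *)
have wS i : w i.+1 = w i + (y - x) ord0 i *: e_ i.
  apply/rowP => j; rewrite !mxE eqxx/= ltnS leq_eqVlt.
  case: (eqVneq j i) => [->|ji]; first by rewrite eqxx ltnn/= mulr1 addrC subrK.
  by rewrite -(inj_eq val_inj) in ji; rewrite (negbTE ji)/= mulr0 addr0.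
have H i : exists z, `|z - x| <= `|y - x| /\
    f (w i.+1) - f (w i) = partial i f z * (y - x) ord0 i.
  have [s _|s /between_dist + E] := @mvt_between R (fun s => f (w i + s *: e_ i))
     (fun s => partial i f (w i + s *: e_ i)) 0 ((y - x) ord0 i).
    by apply: is_derive_line; exact: fD.
  rewrite !subr0 => sb; rewrite subr0 scale0r addr0 -wS in E.
  exists (w i + s *: e_ i); split => //; apply/rV_norm_le => // j.
  rewrite !mxE eqxx/=; case: (eqVneq j i) => [->|ji].
    rewrite ltnn mulr1 addrAC subrr add0r; apply: le_trans sb _.
    exact: coord_le_norm.
  rewrite mulr0 addr0; case: ifP => _; last by rewrite subrr normr0.
  by have := coord_le_norm (y - x) j; rewrite !mxE.
have [xi Hxi] := choice H; exists xi; split=> [i|]; first by have [] := Hxi i.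
have <- : w d = y by apply/rowP => j; rewrite mxE ltn_ord.
have E0 : w 0%N = x by apply/rowP => j; rewrite mxE ltn0.
rewrite -{1}E0 -(telescope_sumr (fun n => f (w n)) (leq0n d)) big_mkord.
apply: eq_bigr => i _; have [_ ->] := Hxi i; congr (_ * _).
by rewrite !mxE ltn_ord.
Qed.

Lemma sum_le_const (F : 'I_d -> R) B : (forall i, F i <= B) -> \sum_i F i <= d%:R * B.
Proof.
move=> FB; apply: le_trans (ler_sum _ (fun i _ => FB i)) _.
by rewrite sumr_const card_ord mulr_natl.
Qed.

Lemma norm_dot_le (v w : V) : `|dot v w| <= d%:R * (`|v| * `|w|).
Proof.
apply: le_trans (ler_norm_sum _ _ _) _; apply: sum_le_const => i.
by rewrite normrM ler_pM// coord_le_norm.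
Qed.

Lemma lipschitz_C1 f L : 0 <= L -> partially_derivable f ->
  (forall i x, `|partial i f x| <= L) -> lipschitz_with (d%:R * L) f.
Proof.
move=> L0 fD fL x y; have [xi [_ ->]] := C1_increment y x fD.
apply: le_trans (ler_norm_sum _ _ _) _; rewrite -mulrA; apply: sum_le_const => i.
by rewrite normrM ler_pM// coord_le_norm.
Qed.

Lemma C1_expansion f : partially_derivable f -> (forall i, unif_cont (partial i f)) ->
  forall e, 0 < e -> exists2 r : R, 0 < r &
    forall x y, `|y - x| <= r -> `|f y - f x - dot (y - x) (grad f x)| <= e * `|y - x|.
Proof.
move=> fD fu e e0; have d1 : 0 < d%:R + 1 :> R by rewrite ltr_wpDl ?ler0n.
have /choice[r Hr] : forall i, exists r, 0 < r /\ forall x y, `|x - y| <= r ->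
    `|partial i f x - partial i f y| <= e / (d%:R + 1).
  by move=> i; have [r r0 Hr] := fu i _ (divr_gt0 e0 d1); exists r.
exists (\big[Num.min/1]_i r i).
  by apply/bigmin_gtP; split => // i _; have [] := Hr i.
move=> x y /bigmin_geP[_ xyr]; have [xi [xix ->]] := C1_increment x y fD.
rewrite /dot -sumrB; apply: le_trans (ler_norm_sum _ _ _) _.
apply: le_trans (sum_le_const (B := e / (d%:R + 1) * `|y - x|) _) _.
  move=> i; rewrite [X in _ - X]mulrC -mulrBl normrM ler_pM// ?coord_le_norm//.
  by rewrite mxE; have [_] := Hr i; apply; apply: le_trans (xix i) (xyr i _).
rewrite mulrA ler_wpM2r// mulrA ler_pdivrMr// mulrC ler_wpM2l ?ltW//; lra.
Qed.

(** Heine-Cantor, with only the first point confined to K, so that the second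
    may leave the closed cube in [periodic_unif_cont]. *)
Lemma compact_unif_cont (K : set V) f : compact K -> continuous f ->
  forall e, 0 < e -> exists2 r : R, 0 < r &
    forall x y, K x -> `|x - y| <= r -> `|f x - f y| <= e.
Proof.
move=> cK fc e e0.
pose P (r : R) x := forall y, `|x - y| <= r -> `|f x - f y| <= e.
have : \forall r \near (0 : R)^'+, K `<=` P r.
  apply: (compact_near_coveringP K).1 cK _ _ _ _ _ => x _.
  have e2 : 0 < e / 2 by rewrite divr_gt0.
  have [q q0 Hq] := (continuous_at_rVP f x).1 (fc x) _ e2.
  have q2 : 0 < q / 2 by rewrite divr_gt0.
  exists (ball x (q / 2), [set r | r < q / 2]).
    by split; [exact: nbhsx_ballx|exact: nbhs_right_lt].
  move=> [z r]/= [+ rq] y zy; rewrite -ball_normE/= => xz.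
  rewrite -(subrKA (f x)); apply: le_trans (ler_normD _ _) _.
  rewrite [leRHS](splitr e) distrC.
  apply: lerD; apply: Hq; first by apply: ltW; apply: lt_trans xz _; lra.
  rewrite -(subrKA z); apply: le_trans (ler_normD _ _) _; lra.
move=> H; have [r [r0 Hr]] : exists r, 0 < r /\ K `<=` P r.
  have : \forall r \near (0 : R)^'+, 0 < r /\ K `<=` P r.
    by near=> r; split; near: r => //; exact: nbhs_right_gt.
  by move/filter_ex.
by exists r => // x y Kx; exact: Hr.
Unshelve. all: by end_near. Qed.

Lemma to_unit_cube x : exists k : 'rV[int]_d, unit_cube R d (x + shift_vec R k).
Proof.
exists (\row_i - Num.floor (x ord0 i)) => i; rewrite !mxE rmorphN/= subr_ge0 ge_floor/=.
by have := lt_succ_floor (x ord0 i); rewrite intrD; lra.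
Qed.

Lemma compact_closed_cube : compact [set y : V | forall i, y ord0 i \in `[0 : R, 1]].
Proof.
apply: (@rV_compact _ _ (fun=> `[0 : R, 1]%classic)) => i; exact: segment_compact.
Qed.

Lemma unit_cube_closed_cube y : unit_cube R d y -> forall i, y ord0 i \in `[0 : R, 1].
Proof. by move=> yc i; rewrite in_itv/=; have /andP[-> /ltW ->] := yc i. Qed.

Lemma periodic_unif_cont f : continuous f -> Defs.periodic f -> unif_cont f.
Proof.
move=> fc fp e e0; have [r r0 fr] := compact_unif_cont compact_closed_cube fc e0.
exists r => // x y xy; have [k xk] := to_unit_cube x.
by rewrite -(fp x k) -(fp y k); apply: fr; [exact: unit_cube_closed_cube|rewrite subr_shift].
Qed.

Lemma periodic_bounded f : continuous f -> Defs.periodic f ->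
  exists2 B : R, 0 <= B & forall x, `|f x| <= B.
Proof.
move=> fc fp; have /compact_bounded[M [_ HM]] : compact
   (f @` [set y : V | forall i, y ord0 i \in `[0 : R, 1]]).
  by apply: continuous_compact compact_closed_cube; exact: continuous_subspaceT.
exists (`|M| + 1) => [|x]; first by rewrite addr_ge0.
have [k xk] := to_unit_cube x; rewrite -(fp x k); apply: HM.
  by rewrite (le_lt_trans (ler_norm _))// ltrDl.
by exists (x + shift_vec R k) => //; exact: unit_cube_closed_cube.
Qed.

Lemma partial_periodic f i : Defs.periodic f -> Defs.periodic (partial i f).
Proof.
move=> fp x k; rewrite /partial /derive.
suff -> : (fun h => h^-1 *: (f (h *: delta_mx ord0 i + (x + shift_vec R k)) - f (x + shift_vec R k)))
  = (fun h => h^-1 *: (f (h *: delta_mx ord0 i + x) - f x)) by [].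
by apply/funext => h; rewrite addrA !fp.
Qed.

Lemma Ck1_partially_derivable f : Ck 1 f -> partially_derivable f.
Proof. by move=> [_ H] i x; have [] := H i. Qed.

Lemma Ck1_partial_continuous f i : Ck 1 f -> continuous (partial i f).
Proof. by move=> [_ H]; have [] := H i. Qed.

Lemma periodic_C1_unif f i : Ck_periodic 1 f -> unif_cont (partial i f).
Proof.
move=> [fC fp]; apply: periodic_unif_cont; last exact: partial_periodic.
exact: Ck1_partial_continuous.
Qed.

Lemma partial_bounded f : Ck_periodic 1 f ->
  exists2 L : R, 0 <= L & forall i x, `|partial i f x| <= L.
Proof.
move=> [fC fp]; have /choice[B HB] : forall i, exists B, 0 <= B /\ forall x, `|partial i f x| <= B.
  move=> i; have [B B0 HB] := periodic_bounded (Ck1_partial_continuous (i := i) fC)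
    (partial_periodic i fp).
  by exists B.
exists (\sum_i B i); first by apply: sumr_ge0 => i _; have [] := HB i.
move=> i x; have [_ /(_ x)/le_trans] := HB i; apply.
by rewrite (bigD1 i)//= lerDl sumr_ge0// => j _; have [] := HB j.
Qed.

Lemma periodic_C1_lipschitz f : Ck_periodic 1 f ->
  exists2 L : R, 0 <= L & lipschitz_with L f.
Proof.
move=> fC; have [L L0 HL] := partial_bounded fC; exists (d%:R * L).
  by rewrite mulr_ge0.
by apply: lipschitz_C1 => //; apply: Ck1_partially_derivable; case: fC.
Qed.

Definition vanishes_beyond (r : R) f := forall x, r < `|x| -> f x = 0.

Lemma compactly_supportedP f : compactly_supported f <->
  exists2 r : R, 0 <= r & vanishes_beyond r f.
Proof.
split.
  move=> /compact_bounded[M [_ HM]]; exists (`|M| + 1); first by rewrite addr_ge0.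
  move=> x; apply: contraTeq => fx; apply/negP => /lt_geF; rewrite HM//.
    by rewrite (le_lt_trans (ler_norm _))// ltrDl.
  exact: subset_closure.
move=> [r r0 fr]; apply: bounded_closed_compact; last exact: closed_closure.
exists r; split=> [|M rM x]; first exact: num_real.
move=> cx; have [//|Mx] := lerP `|x| M.
have [y [/= /eqP fy]] : [set x | f x != 0] `&` ball x (`|x| - M) !=set0.
  by apply: cx; apply: nbhsx_ballx; rewrite subr_gt0.
rewrite -ball_normE/= => xy; case: fy; apply: fr.
have : `|x| <= `|x - y| + `|y| by rewrite -{1}(subrK y x) ler_normD.
lra.
Qed.

End C1_functions.

(** * The flow: Gronwall, uniqueness, expansion in time *)
(** With sg the sign of t, the function s |-> exp(- sg K s) E(s) decreases when
    moving from 0 towards t; this treats both directions of time at once. *)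
Lemma gronwall_scalar (R : realType) (E dE : R -> R) (K t : R) :
  (forall s : R, is_derive s 1 E (dE s)) -> (forall s, `|dE s| <= K * E s) ->
  E t <= expR (K * `|t|) * E 0.
Proof.
move=> ED EK; pose sg : R := if 0 <= t then 1 else -1.
have tE : `|t| = sg * t.
  rewrite /sg; case: (leP 0 t) => t0; first by rewrite mul1r ger0_norm.
  by rewrite mulN1r ltr0_norm.
pose G (s : R) := expR (- (sg * K) * s) * E s.
have GD (s : R) : is_derive s 1 G (expR (- (sg * K) * s) * (dE s - sg * K * E s)).
  have H1 : is_derive s 1 (fun r => expR (- (sg * K) * r)) (- (sg * K) * expR (- (sg * K) * s)).
    have L1 : is_derive s 1 (fun r : R => - (sg * K) * r) (- (sg * K)).
      by have := is_deriveZ (- (sg * K)) (is_derive_id s 1); rewrite [_ *: 1]mulr1.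
    have := @is_derive1_comp _ _ _ _ _ _ (is_derive_expR (- (sg * K) * s)) L1.
    by rewrite [expR _ * _]mulrC; exact.
  apply: (@is_derive_eq _ _ _ _ _ _ _ _ (is_deriveM H1 (ED s))).
  by rewrite /GRing.scale/=; ring.
have [c _ Gt] := @mvt_between _ G _ 0 t (fun s _ => GD s).
have : G t - G 0 <= 0.
  rewrite Gt subr0 -mulrA pmulr_rle0 ?expR_gt0//.
  have := EK c; rewrite ler_norml => /andP[E1 E2].
  rewrite /sg; case: (leP 0 t) => t0; [apply: mulr_le0_ge0|apply: mulr_ge0_le0]; lra.
rewrite /G mulr0 expR0 mul1r subr_le0 => H.
apply: le_trans (ler_wpM2l (expR_ge0 (K * `|t|)) H).
rewrite mulrA -expRD tE (_ : _ + _ = 0) ?expR0 ?mul1r//; ring.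
Qed.

Section flow.
Context {R : realType} {d : nat}.
Local Notation V := 'rV[R]_d.
Implicit Types (s t : R) (x y z : V) (i : 'I_d).

Lemma is_derive_coord (Y : R -> V) t v i : is_derive t 1 Y v ->
  is_derive t 1 (fun s => Y s ord0 i) (v ord0 i).
Proof.
move=> [dY Yv]; have /derivable_mxP H := dY.
by apply: DeriveDef; [exact: H|rewrite -Yv derive_mx// mxE].
Qed.

Definition solution (b : V -> V) (Y : R -> V) := forall t, is_derive t 1 Y (b (Y t)).

(** The scalar lemma is applied to the sum of the squared coordinates, because
    the sup norm is not differentiable; the factor sqrt d is the price of
    comparing the two norms. *)
Lemma gronwall (b : V -> V) Lb Y Z t : 0 <= Lb ->
  (forall x y, `|b x - b y| <= Lb * `|x - y|) -> solution b Y -> solution b Z ->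
  `|Y t - Z t| <= Num.sqrt (expR (2 * d%:R * Lb * `|t|) * d%:R) * `|Y 0 - Z 0|.
Proof.
move=> Lb0 bL Ysol Zsol.
pose D (s : R) i := Y s ord0 i - Z s ord0 i.
pose E (s : R) := \sum_i D s i ^+ 2.
pose dE (s : R) := \sum_i 2 * D s i * (b (Y s) - b (Z s)) ord0 i.
have DE s i : (Y s - Z s) ord0 i = D s i by rewrite !mxE.
have ED s : is_derive s 1 E (dE s).
  have -> : E = \sum_(i < d) (fun s => D s i ^+ 2) by apply/funext => r; rewrite fct_sumE.
  apply: is_derive_sum => i.
  have H : is_derive s 1 (D^~ i) ((b (Y s) - b (Z s)) ord0 i).
    by have := is_deriveB (is_derive_coord i (Ysol s)) (is_derive_coord i (Zsol s)); rewrite !mxE.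
  apply: (@is_derive_eq _ _ _ _ _ _ _ _ (is_deriveX 2 H)).
  by rewrite /GRing.scale/= expr1.
have E0 s : 0 <= E s by apply: sumr_ge0 => i _; exact: sqr_ge0.
have normE s : `|Y s - Z s| ^+ 2 <= E s.
  rewrite -(@sqr_sqrtr _ (E s))// lerXn2r ?nnegrE ?sqrtr_ge0//.
  apply/rV_norm_le; first exact: sqrtr_ge0.
  move=> i; rewrite DE -sqrtr_sqr ler_wsqrtr// /E (bigD1 i)//= lerDl sumr_ge0// => j _.
  exact: sqr_ge0.
have Enorm s : E s <= d%:R * `|Y s - Z s| ^+ 2.
  apply: sum_le_const => i; rewrite -real_normK ?num_real// lerXn2r ?nnegrE//.
  by rewrite -DE coord_le_norm.
have EK s : `|dE s| <= 2 * d%:R * Lb * E s.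
  apply: le_trans (ler_norm_sum _ _ _) _.
  apply: (@le_trans _ _ (d%:R * (2 * (Lb * `|Y s - Z s| ^+ 2)))); last first.
    by rewrite [leRHS](_ : _ = d%:R * (2 * (Lb * E s))); [rewrite !ler_wpM2l|ring].
  apply: sum_le_const => i; rewrite !normrM (ger0_norm (ler0n _ 2)) -mulrA ler_wpM2l//.
  rewrite expr2 mulrCA -DE ler_pM// ?coord_le_norm//.
  by apply: le_trans (bL _ _); exact: coord_le_norm.
have := gronwall_scalar t ED EK => H.
rewrite -[X in X <= _](ger0_norm (normr_ge0 _)) -[leLHS]sqrtr_sqr.
rewrite -[X in _ * X](ger0_norm (normr_ge0 _)) -[X in _ * X]sqrtr_sqr.
rewrite -sqrtrM ?mulr_ge0 ?expR_ge0 ?ler0n// ler_wsqrtr//.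
apply: le_trans (normE t) _; apply: le_trans H _.
by rewrite -[leRHS]mulrA ler_wpM2l ?expR_ge0.
Qed.

Section with_field.
Variables (b : V -> V) (X : R -> V -> V).
Hypotheses (hb : C1_periodic_field b) (hX : is_flow b X).

Lemma field_periodic x k : b (x + shift_vec R k) = b x.
Proof. by apply/rowP => i; have [_ H] := hb i; exact: H. Qed.

Lemma field_bounded : exists2 B : R, 0 <= B & forall x, `|b x| <= B.
Proof.
have /choice[B HB] : forall i, exists B, 0 <= B /\ forall x, `|b x ord0 i| <= B.
  by move=> i; have [[bc _] bp] := hb i; have [B B0 HB] := periodic_bounded bc bp; exists B.
have sB0 : 0 <= \sum_i B i by apply: sumr_ge0 => i _; have [] := HB i.
exists (\sum_i B i) => // x; apply/rV_norm_le => // i; have [_ /(_ x)/le_trans] := HB i.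
by apply; rewrite (bigD1 i)//= lerDl sumr_ge0// => j _; have [] := HB j.
Qed.

Lemma field_lipschitz : exists2 L : R, 0 <= L & forall x y, `|b x - b y| <= L * `|x - y|.
Proof.
have /choice[L HL] : forall i, exists L, 0 <= L /\ lipschitz_with L (fun x => b x ord0 i).
  by move=> i; have [L L0 HL] := periodic_C1_lipschitz (hb i); exists L.
have sL0 : 0 <= \sum_i L i by apply: sumr_ge0 => i _; have [] := HL i.
exists (\sum_i L i) => // x y; apply/rV_norm_le => [|i]; first by rewrite mulr_ge0.
have [_ /(_ x y)/le_trans] := HL i; rewrite !mxE; apply; rewrite ler_wpM2r//.
by rewrite (bigD1 i)//= lerDl sumr_ge0// => j _; have [] := HL j.
Qed.

Lemma flow0 x : X 0 x = x. Proof. by have [] := hX x. Qed.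

Lemma flow_solution x : solution b (X^~ x).
Proof. by move=> t; have [_] := hX x; apply. Qed.

Lemma solution_unique Y Z t : solution b Y -> solution b Z -> Y 0 = Z 0 -> Y t = Z t.
Proof.
move=> Ys Zs YZ; have [Lb Lb0 bL] := field_lipschitz.
have := gronwall t Lb0 bL Ys Zs; rewrite YZ subrr normr0 mulr0 normr_le0 subr_eq0.
by move/eqP.
Qed.

Lemma flow_shift t x k : X t (x + shift_vec R k) = X t x + shift_vec R k.
Proof.
apply: (@solution_unique (X^~ (x + shift_vec R k)) (fun s => X s x + shift_vec R k)).
- exact: flow_solution.
- move=> s; rewrite field_periodic -[b _]addr0.
  exact: (is_deriveD (flow_solution x s) (is_derive_cst (shift_vec R k) s 1)).
- by rewrite !flow0.
Qed.

Lemma flow_add s t x : X (t + s) x = X s (X t x).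
Proof.
apply: (@solution_unique (fun s => X (t + s) x) (X^~ (X t x))).
- move=> r; have [dY Yv] := flow_solution x (t + r).
  have E : (fun h : R => h^-1 *: (X (t + (h *: (1 : R) + r)) x - X (t + r) x)) =
      (fun h => h^-1 *: (X (h *: (1 : R) + (t + r)) x - X (t + r) x)).
    by apply/funext => h; rewrite addrCA.
  by apply: DeriveDef; rewrite /derivable /derive E.
- exact: flow_solution.
- by rewrite addr0 flow0.
Qed.

Lemma flow_lipschitz t : exists2 L : R, 0 <= L & forall x y, `|X t x - X t y| <= L * `|x - y|.
Proof.
have [Lb Lb0 bL] := field_lipschitz; eexists; last first.
  move=> x y; have := gronwall t Lb0 bL (flow_solution x) (flow_solution y).
  by rewrite !flow0; exact.
exact: sqrtr_ge0.
Qed.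

Lemma flow_dist B s x : (forall x, `|b x| <= B) -> `|X s x - x| <= B * `|s|.
Proof.
move=> bB; have B0 : 0 <= B := le_trans (normr_ge0 _) (bB x).
apply/rV_norm_le => [|i]; first by rewrite mulr_ge0.
have [c _] := @mvt_between _ (fun s => X s x ord0 i) (fun s => b (X s x) ord0 i) 0 s
  (fun s _ => is_derive_coord i (flow_solution x s)).
rewrite flow0 subr0 !mxE => ->; rewrite normrM ler_wpM2r//.
by apply: le_trans (bB (X c x)); exact: coord_le_norm.
Qed.

Lemma flow_expansion B L s x : (forall x, `|b x| <= B) -> 0 <= L ->
  (forall x y, `|b x - b y| <= L * `|x - y|) ->
  `|X s x - x - s *: b x| <= L * B * `|s| ^+ 2.
Proof.
move=> bB L0 bL; have B0 : 0 <= B := le_trans (normr_ge0 _) (bB x).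
apply/rV_norm_le => [|i]; first by rewrite !mulr_ge0.
have [c /between_dist] := @mvt_between _ (fun s => X s x ord0 i) (fun s => b (X s x) ord0 i) 0 s
  (fun s _ => is_derive_coord i (flow_solution x s)).
rewrite flow0 !subr0 !mxE => cs ->.
rewrite mulrC -mulrBr normrM mulrC expr2 mulrA ler_wpM2r//.
have := coord_le_norm (b (X c x) - b x) i; rewrite !mxE => /le_trans; apply.
apply: le_trans (bL _ _) _; rewrite -mulrA ler_wpM2l//.
by apply: le_trans (flow_dist c x bB) _; rewrite ler_wpM2l.
Qed.

End with_field.
End flow.

(** * Derivatives along the flow and the commutator estimate *)
Section along_flow.
Context {R : realType} {d : nat}.
Local Notation V := 'rV[R]_d.
Implicit Types (s t a e eps L : R) (u f g : V -> R) (x y z : V) (i : 'I_d).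
Variables (b : V -> V) (X : R -> V -> V).
Hypotheses (hb : C1_periodic_field b) (hX : is_flow b X).

(** g is the derivative of u along the flow, uniformly in the starting point;
    u need not have partial derivatives. *)
Definition flow_derivative u g := forall e : R, 0 < e -> exists2 r : R, 0 < r &
  forall s x, `|s| <= r -> `|u (X s x) - u x - s * g x| <= e * `|s|.

Lemma dotBl (v w z : V) : dot (v - w) z = dot v z - dot w z.
Proof. by rewrite /dot -sumrB; apply: eq_bigr => i _; rewrite !mxE mulrBl. Qed.

Lemma dotZl a (v w : V) : dot (a *: v) w = a * dot v w.
Proof. by rewrite /dot mulr_sumr; apply: eq_bigr => i _; rewrite !mxE mulrA. Qed.

(** Insert X(s,x) - x = s b(x) + O(s^2) into the first-order expansion of f. *)
Lemma C1_flow_derivative f : Ck_periodic 1 f ->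
  flow_derivative f (fun x => dot (b x) (grad f x)).
Proof.
move=> fC e e0; have [fC1 _] := fC.
have [B B0 bB] := field_bounded hb; have [L L0 bL] := field_lipschitz hb.
have [G G0 fG] := partial_bounded fC.
have gG x : `|grad f x| <= G by apply/rV_norm_le => // i; rewrite mxE.
have B1 : 0 < B + 1 by lra.
have [|r r0 fr] := C1_expansion (Ck1_partially_derivable fC1)
  (fun i => periodic_C1_unif i fC) (e := e / 2 / (B + 1)).
  by rewrite !divr_gt0.
pose K := d%:R * (L * B * G).
have K0 : 0 <= K by rewrite !mulr_ge0 ?ler0n.
exists (Num.min (r / (B + 1)) (e / 2 / (K + 1))).
  by rewrite lt_min !divr_gt0//; lra.
move=> s x; rewrite le_min => /andP[sr sK].
have Xs : `|X s x - x| <= B * `|s| := flow_dist hX s x bB.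
have Xr : `|X s x - x| <= r.
  apply: le_trans Xs _; rewrite ler_pdivlMr// in sr; apply: le_trans sr.
  by rewrite mulrC ler_wpM2l//; lra.
have -> : f (X s x) - f x - s * dot (b x) (grad f x) =
   (f (X s x) - f x - dot (X s x - x) (grad f x)) + dot (X s x - x - s *: b x) (grad f x).
  by rewrite [dot (_ - _ - _) _]dotBl dotZl; ring.
apply: le_trans (ler_normD _ _) _.
rewrite [leRHS](_ : _ = e / 2 * `|s| + e / 2 * `|s|); last by field.
apply: lerD.
  apply: le_trans (fr _ _ Xr) _; rewrite -[leLHS]mulrA; apply: ler_wpM2l; first by lra.
  rewrite mulrC ler_pdivrMr//; apply: le_trans Xs _.
  by rewrite mulrC ler_wpM2l//; lra.
apply: le_trans (norm_dot_le _ _) _.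
apply: (@le_trans _ _ (K * `|s| * `|s|)).
  rewrite [leRHS](_ : _ = d%:R * (L * B * `|s| ^+ 2 * G)); last by rewrite /K; ring.
  by rewrite ler_wpM2l ?ler0n// ler_pM//; exact: (flow_expansion hX).
rewrite ler_wpM2r//; rewrite ler_pdivlMr in sK; last by lra.
by apply: le_trans sK; rewrite mulrC ler_wpM2l//; lra.
Qed.

Lemma flow_derivative_shift u g t : flow_derivative u g ->
  flow_derivative (fun x => u (X t x)) (fun x => g (X t x)).
Proof.
move=> ug e e0; have [r r0 H] := ug e e0; exists r => // s x sr.
have -> : X t (X s x) = X s (X t x) by rewrite -!(flow_add hb hX) addrC.
exact: H.
Qed.

(** The commutator estimate.  For fixed x, the increment of M u in the direction
    s b(x) is M applied to y |-> u(y + s b(x)) - u(y), and by locality only the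
    y with |y - x| <= d eps matter.  For these, y + s b(x) is within
    s Lip(b) d eps + O(s^2) of X(s, y), so the increment is s g(y) up to
    Lip(u) times that distance, and g(y) is close to g(x).  Dividing by a small
    s bounds b . grad (M u) - g. *)
Lemma smooth_flow_derivative L u g : 0 <= L -> lipschitz_with L u -> unif_cont g ->
  flow_derivative u g -> forall e, 0 < e -> exists2 eps0 : R, 0 < eps0 &
  forall eps, 0 < eps -> eps <= eps0 ->
    forall x, `|dot (b x) (grad (smooth eps 0%N u) x) - g x| <= e.
Proof.
move=> L0 uL gu ug e e0.
have [B B0 bB] := field_bounded hb; have [Lb Lb0 bL] := field_lipschitz hb.
have e5 : 0 < e / 5 by rewrite divr_gt0.
have [rg rg0 gr] := gu _ e5.
have d1 : 0 < d%:R + 1 :> R by rewrite ltr_wpDl ?ler0n.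
pose K := L * Lb * d%:R; have K0 : 0 <= K by rewrite !mulr_ge0 ?ler0n.
exists (Num.min (rg / (d%:R + 1)) (e / 5 / (K + 1))).
  by rewrite lt_min !divr_gt0//; lra.
move=> eps eps0; rewrite le_min => /andP[epsr epsK] x.
have epsd : d%:R * eps <= rg.
  rewrite ler_pdivlMr// in epsr; apply: le_trans epsr.
  by rewrite mulrC ler_wpM2l//; lra.
have epsK' : K * eps <= e / 5.
  rewrite ler_pdivlMr in epsK; last by lra.
  by apply: le_trans epsK; rewrite mulrC ler_wpM2l//; lra.
set m := smooth eps 0%N u; set v := b x.
have mC k : Ck k m by exact: (smooth_Ck eps0 L0 uL 0%N k).
have mP i : unif_cont (partial i m) := smooth_partial_unif_cont eps0 L0 uL 0%N i.
have B1 : 0 < B + 1 by lra.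
have [|r1 r10 Hm] := C1_expansion (Ck1_partially_derivable (mC 1%N)) mP (e := e / 5 / (B + 1)).
  by rewrite !divr_gt0.
have [r2 r20 Hu] := ug _ e5.
pose K2 := L * (Lb * B); have K20 : 0 <= K2 by rewrite !mulr_ge0.
(* a single s suffices: its second-order errors must be at most s e / 5 *)
have [s s0 [sr1 sr2 sK2]] : exists2 s : R, 0 < s & [/\ B * s <= r1, s <= r2 & K2 * s <= e / 5].
  exists (Num.min (r1 / (B + 1)) (Num.min r2 (e / 5 / (K2 + 1)))).
    by rewrite !lt_min r20 !divr_gt0//; lra.
  set s := Num.min _ _.
  have : s <= s by [].
  rewrite {2}/s !le_min => /and3P[S1 S2 S3].
  have s0 : 0 <= s by rewrite !le_min !divr_ge0// ltW//; lra.
  rewrite ler_pdivlMr// in S1; rewrite ler_pdivlMr in S3; last by lra.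
  by split => //; nra.
have ns : `|s| = s by rewrite gtr0_norm.
have M1 : `|m (x + s *: v) - m x - s * g x| <= s * (e / 5 + e / 5 + e / 5 + e / 5).
  have Lu' : lipschitz_with L (fun y => u (y + s *: v)) by exact: lipschitz_shift.
  have -> : m (x + s *: v) - m x = smooth eps 0%N (fun y => -1 * u y + u (y + s *: v)) x.
    rewrite (smooth_lin eps0 0%N (-1) x L0 uL L0 Lu') (smooth_shift eps0) /m; ring.
  apply: (@smooth_local _ _ _ eps0 0%N (L + L)) => //; first by lra.
    move=> y z; have -> : - 1 * u y + u (y + s *: v) - (-1 * u z + u (z + s *: v)) =
      (u (y + s *: v) - u (z + s *: v)) - (u y - u z) by ring.
    by rewrite (le_trans (ler_normB _ _))// mulrDl lerD.
  move=> z; rewrite expr0 divr1 => zeps.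
  set y := x + z.
  have -> : - 1 * u y + u (y + s *: v) - s * g x =
     (u (y + s *: v) - u (X s y)) + ((u (X s y) - u y - s * g y) + s * (g y - g x)) by ring.
  apply: le_trans (ler_normD _ _) _.
  rewrite [leRHS](_ : _ = s * (e / 5 + e / 5) + (s * (e / 5) + s * (e / 5))); last by ring.
  apply: lerD.
    apply: le_trans (uL _ _) _.
    have : `|y + s *: v - X s y| <= s * (Lb * (d%:R * eps)) + Lb * B * s ^+ 2.
      have -> : y + s *: v - X s y = s *: (v - b y) - (X s y - y - s *: b y).
        by rewrite scalerBr; apply/rowP => i; rewrite !mxE; ring.
      apply: le_trans (ler_normB _ _) _; apply: lerD.
        rewrite normrZ ns (ler_wpM2l (ltW s0))//; apply: le_trans (bL _ _) _.
        by rewrite ler_wpM2l// distrC /y addrAC subrr add0r.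
      by have := flow_expansion hX s y bB Lb0 bL; rewrite ns.
    move/(ler_wpM2l L0)/le_trans; apply.
    rewrite [leLHS](_ : _ = s * (K * eps + K2 * s)); last by rewrite /K /K2; ring.
    by rewrite (ler_wpM2l (ltW s0))// lerD.
  apply: le_trans (ler_normD _ _) _; apply: lerD.
    by have := Hu s y; rewrite ns [_ / 5 * s]mulrC; exact.
  rewrite normrM ns (ler_wpM2l (ltW s0))//; apply: gr.
  by rewrite /y addrAC subrr add0r; apply: le_trans epsd.
have M2 : `|m (x + s *: v) - m x - s * dot v (grad m x)| <= s * (e / 5).
  have := Hm x (x + s *: v); rewrite addrAC subrr add0r dotZl normrZ ns => H.
  apply: le_trans (H _) _.
    by apply: le_trans sr1; rewrite mulrC (ler_wpM2r (ltW s0))//; exact: bB.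
  rewrite [leLHS](_ : _ = s * (e / 5 / (B + 1) * `|v|)); last by ring.
  rewrite (ler_wpM2l (ltW s0))// mulrAC ler_pdivrMr// (ler_wpM2l (ltW e5))//.
  by apply: le_trans (bB x) _; lra.
rewrite -(ler_pM2l s0) -{1}ns -normrM mulrBr.
have -> : s * dot v (grad m x) - s * g x =
  (m (x + s *: v) - m x - s * g x) - (m (x + s *: v) - m x - s * dot v (grad m x)) by ring.
apply: le_trans (ler_normB _ _) _; lra.
Qed.

End along_flow.

(** * Periodization, and a bump whose integer translates sum to one *)
Section periodization.
Context {R : realType} {d : nat}.
Local Notation V := 'rV[R]_d.
Local Notation e_ i := (@unitv R d i).
Implicit Types (r s eps L : R) (u f g : V -> R) (x y z : V) (i : 'I_d) (k : 'rV[int]_d).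

Lemma lattice_box (N : nat) : exists A : {fset 'rV[int]_d},
  forall k, k \notin A -> exists i, N%:Z < `|k ord0 i|.
Proof.
pose g (h : {ffun 'I_d -> 'I_(N.*2.+1)}) : 'rV[int]_d := \row_i ((h i)%:Z - N%:Z).
have fin : finite_set (range g) by apply: finite_image; exact: finite_finset.
exists (fset_set (range g)) => k kA; apply: contrapT => /forallNP kN.
move/negP: kA; apply; rewrite in_fset_set// inE/=.
have kb i : - N%:Z <= k ord0 i <= N%:Z by rewrite -ler_norml leNgt; apply/negP; exact: kN.
exists [ffun i => inord (absz (k ord0 i + N%:Z))] => //.
apply/rowP => i; rewrite mxE ffunE; have /andP[k1 k2] := kb i.
rewrite inordK; last by rewrite -addnn; lia.
by rewrite gez0_abs; [rewrite addrK|lia].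
Qed.

(** On a bounded set a single finite sum computes the periodizations of all
    functions with a given bound on the support, which lets derivatives and
    limits be taken term by term. *)
Lemma periodization_finite rho r : exists A : seq 'rV[int]_d,
  forall f, vanishes_beyond rho f -> forall y, `|y| <= r ->
    periodization f y = \sum_(k <- A) f (y + shift_vec R k).
Proof.
have [N HN] : exists N : nat, rho + r <= N%:R.
  exists (Num.truncn (Num.max 0 (rho + r))).+1.
  by rewrite ltW// (le_lt_trans _ (truncnS_gt _))// le_max lexx orbT.
have [A HA] := lattice_box N; exists A => f f0 y yr.
apply: fsbigTE => k /HA[i Nk]; apply: f0.
have := coord_le_norm (y + shift_vec R k) i; rewrite !mxE.
have := coord_le_norm y i.
have : N%:R < `|(k ord0 i)%:~R| :> R by rewrite -intr_norm -[N%:R]/(N%:Z%:~R) ltr_int.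
have := ler_normB (y ord0 i + (k ord0 i)%:~R) (y ord0 i).
rewrite addrAC subrr add0r; lra.
Qed.

Lemma shift_vecD k l : shift_vec R (k + l) = shift_vec R k + shift_vec R l.
Proof. by apply/rowP => i; rewrite !mxE intrD. Qed.

Lemma periodization_periodic f : Defs.periodic (periodization f).
Proof.
move=> x l; rewrite /periodization [RHS](reindex_fsbigT (fun k => l + k)); last first.
  by exists (fun k => - l + k) => k; rewrite ?addKr ?addNKr.
by apply: eq_fsbigr => k _; rewrite shift_vecD addrA.
Qed.

Lemma continuous_sum (I : Type) (l : seq I) (F : I -> V -> R) :
  (forall j, continuous (F j)) -> continuous (fun y => \sum_(j <- l) F j y).
Proof.
move=> Fc x; elim: l => [|j l IH].
  by under eq_fun do rewrite big_nil; exact: cst_continuous.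
under eq_fun do rewrite big_cons.
exact: (@cvgD _ _ _ _ (nbhs_filter x) _ _ _ _ (Fc j x) IH).
Qed.

Lemma continuous_shift z f : continuous f -> continuous (fun y => f (y + z)).
Proof.
move=> fc x; apply/continuous_at_rVP => e e0.
have [r r0 H] := (continuous_at_rVP f (x + z)).1 (fc _) e e0.
by exists r => // y xy; apply: H; rewrite subr_shift.
Qed.

Lemma near_norm x : \forall y \near x, `|y| <= `|x| + 1.
Proof.
apply/nbhs_ballP; exists 1 => //= y; rewrite -ball_normE/= => xy.
by rewrite -{1}(subrK x y) (le_trans (ler_normD _ _))// addrC lerD2l distrC ltW.
Qed.

Lemma periodization_continuous rho f : vanishes_beyond rho f -> continuous f ->
  continuous (periodization f).
Proof.
move=> f0 fc x; have [A HA] := periodization_finite rho (`|x| + 1).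
apply/continuous_at_rVP => e e0.
have Sc : continuous (fun y => \sum_(k <- A) f (y + shift_vec R k)).
  by apply: (continuous_sum (F := fun k y => f (y + shift_vec R k))) => k; exact: continuous_shift.
have [r r0 H] := (continuous_at_rVP _ x).1 (Sc x) e e0.
exists (Num.min r 1) => [|y]; first by rewrite lt_min r0/=.
rewrite le_min => /andP[xyr xy1]; rewrite !(HA f)//; first exact: H.
- by rewrite -{1}(subrK x y) (le_trans (ler_normD _ _))// addrC lerD2l distrC.
- by rewrite lerDl.
Qed.

Lemma partial_vanishes rho f i : vanishes_beyond rho f -> vanishes_beyond rho (partial i f).
Proof.
move=> f0 x xr; transitivity ('D_(delta_mx ord0 i) (cst (0 : R)) x); last exact: derive_cst.
apply: near_eq_derive; apply/nbhs_ballP; exists (`|x| - rho); first by rewrite /= subr_gt0.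
move=> y; rewrite -ball_normE/= => xy; rewrite /cst f0//.
have := ler_normD (x - y) y; rewrite subrK; lra.
Qed.

Lemma is_derive_periodization rho f i x : vanishes_beyond rho f ->
  partially_derivable f ->
  is_derive x (e_ i) (periodization f) (periodization (partial i f) x).
Proof.
move=> f0 fD; have [A HA] := periodization_finite rho (`|x| + 1).
rewrite (HA _ (partial_vanishes i f0)) ?lerDl//.
apply: (@near_eq_is_derive _ _ _ (fun y => \sum_(k <- A) f (y + shift_vec R k))).
  by apply: filterS (near_norm x) => y xy; rewrite (HA f).
elim: A {HA} => [|k A IH].
  rewrite big_nil; under eq_fun do rewrite big_nil; exact: is_derive_cst.
rewrite big_cons; under eq_fun do rewrite big_cons.
apply: (is_deriveD _ IH).
have E : (fun h : R => h^-1 *: (f (h *: e_ i + x + shift_vec R k) - f (x + shift_vec R k))) =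
    (fun h : R => h^-1 *: (f (h *: e_ i + (x + shift_vec R k)) - f (x + shift_vec R k))).
  by apply/funext => h; rewrite addrA.
by apply: DeriveDef; rewrite /derivable /derive E//; exact: fD.
Qed.

Lemma periodization_C1 rho f : vanishes_beyond rho f -> Ck 1 f ->
  Ck_periodic 1 (periodization f).
Proof.
move=> f0 fC; have fD := Ck1_partially_derivable fC.
split; last exact: periodization_periodic.
split; first by apply: periodization_continuous f0 _; case: fC.
move=> i; split=> [x|]; first by have [] := is_derive_periodization i x f0 fD.
suff -> : partial i (periodization f) = periodization (partial i f).
  exact: periodization_continuous (partial_vanishes i f0) (Ck1_partial_continuous fC).
by apply/funext => x; have [_ H] := is_derive_periodization i x f0 fD; exact: H.
Qed.

(** The periodic factor b can be taken out of the sum over translates. *)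
Lemma periodization_dot_grad rho f (b : V -> V) y : vanishes_beyond rho f ->
  partially_derivable f -> (forall x k, b (x + shift_vec R k) = b x) ->
  periodization (fun x => dot (b x) (grad f x)) y = dot (b y) (grad (periodization f) y).
Proof.
move=> f0 fD bp; have [A HA] := periodization_finite rho `|y|.
rewrite (HA (fun x => dot (b x) (grad f x)))//; last first.
  by move=> x xr; rewrite /dot big1// => i _; rewrite mxE (partial_vanishes i f0)// mulr0.
rewrite /dot exchange_big/=; apply: eq_bigr => i _.
rewrite mxE [partial _ _ _](_ : _ = periodization (partial i f) y); last first.
  by have [_ H] := is_derive_periodization i y f0 fD; exact: H.
rewrite (HA _ (partial_vanishes i f0))// mulr_sumr.
by apply: eq_bigr => k _; rewrite bp mxE.
Qed.

Definition tent (t : R) := Num.max 0 (1 - `|t|).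

Lemma tent_ge0 t : 0 <= tent t. Proof. by rewrite le_max lexx. Qed.
Lemma tent_le1 t : tent t <= 1.
Proof. by rewrite ge_max ler01 lerBlDr lerDl normr_ge0. Qed.
Lemma tent_eq0 t : 1 <= `|t| -> tent t = 0.
Proof. by move=> t1; apply/max_idPl; rewrite subr_le0. Qed.

Lemma tent_lipschitz s t : `|tent s - tent t| <= `|s - t|.
Proof.
have /= := ler_dist_dist s t; rewrite /tent.
by case: (lerP 0 (1 - `|s|)); case: (lerP 0 (1 - `|t|)); rewrite !ler_norml;
  move=> ? ? /andP[? ?]; apply/andP; split; try lra;
  have := normr_ge0 (s - t); lra.
Qed.

(** A cut-off that is only Lipschitz: it multiplies u before mollification,
    which then supplies the smoothness. *)
Definition bump x : R := \prod_i tent (x ord0 i).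

Lemma prod_dist_le (l : seq 'I_d) (a c : 'I_d -> R) r :
  (forall i, 0 <= a i <= 1) -> (forall i, 0 <= c i <= 1) ->
  (forall i, `|a i - c i| <= r) ->
  `|\prod_(i <- l) a i - \prod_(i <- l) c i| <= (size l)%:R * r.
Proof.
move=> a1 c1 ac; elim: l => [|i l IH]; first by rewrite !big_nil subrr normr0 mul0r.
rewrite !big_cons /= -natr1 mulrDl mul1r.
set P := \prod_(j <- l) a j in IH *; set Q := \prod_(j <- l) c j in IH *.
have Q1 : 0 <= Q <= 1.
  apply/andP; split; first by apply: prodr_ge0 => j _; have /andP[] := c1 j.
  by apply: prodr_ile1 => j _.
have -> : a i * P - c i * Q = a i * (P - Q) + Q * (a i - c i) by ring.
apply: le_trans (ler_normD _ _) _; rewrite !normrM; apply: lerD.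
  by apply: le_trans IH; rewrite ler_piMl//; have /andP[? ?] := a1 i; rewrite ger0_norm.
by apply: le_trans (ac i); rewrite ler_piMl//; have /andP[? ?] := Q1; rewrite ger0_norm.
Qed.

Lemma bump_lipschitz : lipschitz_with d%:R bump.
Proof.
move=> x y; rewrite /bump -[X in X%:R * _](card_ord d) cardE enumT.
apply: prod_dist_le => i; rewrite ?tent_ge0 ?tent_le1//.
apply: le_trans (tent_lipschitz _ _) _.
by have := coord_le_norm (x - y) i; rewrite !mxE.
Qed.

Lemma bump_bound x : `|bump x| <= 1.
Proof.
rewrite ger0_norm; last by apply: prodr_ge0 => i _; exact: tent_ge0.
by apply: prodr_ile1 => i _; rewrite tent_ge0 tent_le1.
Qed.

Lemma bump_vanishes : vanishes_beyond 1 bump.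
Proof.
move=> x x1; have [i xi] : exists i, 1 < `|x ord0 i|.
  apply: contrapT => /forallNP H; have := rV_norm_le x ler01 => -[_ H'].
  move: x1; rewrite ltNge H'// => i; rewrite leNgt; apply/negP; exact: H.
by rewrite /bump (bigD1 i)//= tent_eq0 ?mul0r// ltW.
Qed.

(** For y in the unit cube only the translates by vectors with entries 0 and -1
    contribute, and their sum factors into a product over the coordinates of
    tent(y_i) + tent(y_i - 1) = (1 - y_i) + y_i. *)
Lemma periodization_bump y : periodization bump y = 1.
Proof.
have [l lc] := to_unit_cube y; rewrite -(periodization_periodic bump y l).
move: {y} (y + _) lc => y yc.
pose g (h : {ffun 'I_d -> bool}) : 'rV[int]_d := \row_i - (h i)%:R.
have g_inj : injective g.
  move=> h1 h2 /rowP E; apply/ffunP => i; have := E i; rewrite !mxE => /oppr_inj.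
  by case: (h1 i); case: (h2 i).
have -> : periodization bump y = \sum_(k \in range g) bump (y + shift_vec R k).
  apply/esym; apply: fsbig_widen => // k [_ kg]/=.
  have [i [k0 k1]] : exists i, k ord0 i <> 0 /\ k ord0 i <> -1.
    apply: contrapT => /forallNP H; apply: kg; exists [ffun i => k ord0 i != 0] => //.
    apply/rowP => i; rewrite !mxE ffunE; have := H i.
    case: (eqVneq (k ord0 i) 0) => [->//|k0 H']; apply/esym; apply: contrapT => k1.
    by apply: H'; split => //; exact/eqP.
  rewrite /bump (bigD1 i)//= tent_eq0 ?mul0r// !mxE.
  have /andP[y0 y1] := yc i.
  have [k2|k2] : (1 <= k ord0 i) \/ (k ord0 i <= -2) by lia.
    by rewrite -(@ler_int R) in k2; rewrite ler_normr; apply/orP; left; lra.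
  by rewrite -(@ler_int R) in k2; rewrite ler_normr; apply/orP; right; lra.
rewrite (fsbig_image (R := R)); last by move=> h1 h2 _ _; exact: g_inj.
have -> : [set: {ffun 'I_d -> bool}] = [set` index_enum {ffun 'I_d -> bool}].
  by apply/seteqP; split => h // _; rewrite /= mem_index_enum.
rewrite -fsbig_seq ?index_enum_uniq//.
transitivity (\sum_(h : {ffun 'I_d -> bool}) \prod_i tent (y ord0 i - (h i)%:R)).
  by apply: eq_bigr => h _; apply: eq_bigr => i _; rewrite !mxE rmorphN/= natz.
rewrite -(bigA_distr_bigA (fun i (c : bool) => tent (y ord0 i - c%:R))) big1// => i _.
have /andP[y0 y1] := yc i; rewrite big_bool/= subr0 /tent.
rewrite ltr0_norm ?subr_lt0// ger0_norm//.
by rewrite !max_r; lra.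
Qed.

Section smooth_periodic.
Variables (eps L : R) (u : V -> R).
Hypotheses (eps0 : 0 < eps) (eps1 : d%:R * eps <= 1) (L0 : 0 <= L).
Hypotheses (uL : lipschitz_with L u) (up : Defs.periodic u).

Lemma bump_mul_lipschitz : exists2 L' : R, 0 <= L' & lipschitz_with L' (fun x => bump x * u x).
Proof.
have [B B0 uB] := periodic_bounded (unif_cont_continuous (lipschitz_unif_cont uL)) up.
exists (L + B * d%:R) => [|x y]; first by rewrite addr_ge0 ?mulr_ge0 ?ler0n.
have -> : bump x * u x - bump y * u y = bump x * (u x - u y) + u y * (bump x - bump y) by ring.
apply: le_trans (ler_normD _ _) _; rewrite mulrDl !normrM; apply: lerD.
  by apply: le_trans (uL x y); rewrite ler_piMl// bump_bound.
by rewrite -mulrA ler_pM//; exact: bump_lipschitz.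
Qed.

(** The test function whose periodization is the mollification of u. *)
Definition smooth_cell := smooth eps 0%N (fun x => bump x * u x).

Lemma smooth_cell_vanishes : vanishes_beyond 2 smooth_cell.
Proof.
move=> x x2; have [L' L'0 HL'] := bump_mul_lipschitz; apply/eqP.
rewrite -normr_le0 -[smooth_cell x]subr0.
apply: (smooth_local eps0 L'0 HL'); rewrite expr0 divr1 => z ze.
rewrite bump_vanishes ?mul0r ?subrr ?normr0//.
have := ler_normB (x + z) z; rewrite addrK.
have := le_trans ze eps1; lra.
Qed.

Lemma smooth_cell_test : test_function smooth_cell.
Proof.
have [L' L'0 HL'] := bump_mul_lipschitz; split=> [k|].
  exact: (smooth_Ck eps0 L'0 HL').
by apply/compactly_supportedP; exists 2 => //; exact: smooth_cell_vanishes.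
Qed.

Lemma smooth_eq_local v w L1 L2 x : 0 <= L1 -> lipschitz_with L1 v ->
  0 <= L2 -> lipschitz_with L2 w -> (forall z, `|z| <= 1 -> v (x + z) = w (x + z)) ->
  smooth eps 0%N v x = smooth eps 0%N w x.
Proof.
move=> L10 vL L20 wL vw; apply/eqP; rewrite -subr_eq0 -normr_le0.
have := smooth_lin eps0 0%N (-1) x L20 wL L10 vL; rewrite mulN1r addrC => <-.
rewrite -[smooth _ _ _ _]subr0.
have vwL : lipschitz_with (L2 + L1) (fun y => -1 * w y + v y).
  move=> y z; have -> : - 1 * w y + v y - (-1 * w z + v z) = (v y - v z) - (w y - w z) by ring.
  by rewrite (le_trans (ler_normB _ _))// mulrDl addrC lerD.
apply: (smooth_local eps0 (addr_ge0 L20 L10) vwL); rewrite expr0 divr1 => z ze.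
by rewrite vw ?(le_trans ze)// mulN1r addNr subrr normr0.
Qed.

(** Mollification commutes with translations and with finite sums, and near y
    the translates of bump * u add up to u. *)
Lemma periodization_smooth_cell y : periodization smooth_cell y = smooth eps 0%N u y.
Proof.
have [L' L'0 HL'] := bump_mul_lipschitz.
have [A HA] := periodization_finite 2 (`|y| + 1).
have bump2 : vanishes_beyond 2 bump by move=> x x2; apply: bump_vanishes; lra.
rewrite (HA _ smooth_cell_vanishes); last by rewrite lerDl.
pose F k x := bump (x + shift_vec R k) * u (x + shift_vec R k).
have FL k : lipschitz_with L' (F k).
  by move=> a c; exact: (lipschitz_shift (shift_vec R k) HL').
transitivity (\sum_(k <- A) smooth eps 0%N (F k) y).
  by apply: eq_bigr => k _; rewrite /smooth_cell -(smooth_shift eps0).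
rewrite -(smooth_sum eps0 A 0%N y L'0 FL).
have SL := lipschitz_sum A FL.
apply: smooth_eq_local SL L0 uL _; first by rewrite mulr_ge0 ?ler0n.
move=> z z1; under eq_bigr do rewrite /F up.
rewrite -mulr_suml -(HA bump bump2) ?periodization_bump ?mul1r//.
by rewrite (le_trans (ler_normD _ _))// lerD2l.
Qed.

End smooth_periodic.
End periodization.

(** * Means of continuous periodic functions *)
Section mean.
Context {R : realType} {d : nat}.
Local Notation V := 'rV[R]_d.
Implicit Types (f g u : V -> R) (B e s t a : R) (x y : V).

Lemma continuous_measurable_borelRV f : continuous f ->
  measurable_fun setT (f : borelRV R d -> R).
Proof.
move=> /continuousP fc; apply: (measurability _ (RGenOpens.measurableE R)).
move=> _ [_ [a [b ->] <-]]; rewrite setTI; apply: sub_sigma_algebra.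
exact/fc/interval_open.
Qed.

Lemma measurable_unit_cube : measurable (unit_cube R d : set (borelRV R d)).
Proof.
have -> : unit_cube R d = \bigcap_(i in [set: 'I_d]) ((fun y : V => y ord0 i) @^-1` `[0, 1[).
  apply/seteqP; split => y /= yc i; first by move=> _; rewrite /= in_itv/= yc.
  by have := yc i Logic.I; rewrite /= in_itv.
apply: fin_bigcap_measurable => [|i _]; first exact: finite_finset.
rewrite -[X in measurable X]setTI.
apply: (continuous_measurable_borelRV (f := fun y => y ord0 i)) => //; exact: coord_continuous.
Qed.

Definition cont_periodic f := continuous f /\ Defs.periodic f.

Variable mu : probability (borelRV R d) R.
Hypothesis hmu : torus_measure mu.

Definition mean f : R := \int[mu]_(y in unit_cube R d) f y.

Lemma cont_periodic_integrable f : cont_periodic f ->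
  mu.-integrable (unit_cube R d) (EFin \o (f : borelRV R d -> R)).
Proof.
move=> [fc fp]; apply: measurable_bounded_integrable.
- exact: measurable_unit_cube.
- by rewrite [X in (X < _)%E](hmu : _ = 1%E) ltry.
- by apply: measurable_funTS; exact: continuous_measurable_borelRV.
- have [B B0 fB] := periodic_bounded fc fp.
  by exists B; split=> [|M BM y _]; [exact: num_real|exact: le_trans (fB y) (ltW BM)].
Qed.

Lemma mean_integral f : cont_periodic f ->
  (\int[mu]_(y in unit_cube R d) (f y)%:E = (mean f)%:E)%E.
Proof.
move=> fP; rewrite /mean /Rintegral fineK//.
apply: integrable_fin_num; first exact: measurable_unit_cube.
exact: cont_periodic_integrable.
Qed.

Lemma mean_lin a f g : cont_periodic f -> cont_periodic g ->
  mean (fun x => a * f x + g x) = a * mean f + mean g.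
Proof.
move=> fP gP; have mC := measurable_unit_cube.
have [fi gi] := (cont_periodic_integrable fP, cont_periodic_integrable gP).
rewrite /mean RintegralD// ?RintegralZl//.
exact: (integrableZl mC a fi).
Qed.

Lemma mean_bound f B : cont_periodic f -> (forall x, `|f x| <= B) -> `|mean f| <= B.
Proof.
move=> fP fB; have B0 := le_trans (normr_ge0 _) (fB 0).
rewrite -lee_fin -abse_EFin -mean_integral//.
have mC := measurable_unit_cube.
have mf : measurable_fun (unit_cube R d : set (borelRV R d)) (fun y : borelRV R d => (f y)%:E).
  apply/measurable_EFinP; apply: measurable_funTS.
  by apply: continuous_measurable_borelRV; case: fP.
apply: le_trans (le_abse_integral mu mC mf) _.
apply: le_trans (integral_le_bound B%:E mC mf _ _) _.
- by rewrite lee_fin.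
- by apply: aeW => x _; rewrite lee_fin.
- by rewrite [X in (_ * X)%E](hmu : _ = 1%E) mule1.
Qed.

Lemma cont_periodic_lin a f g : cont_periodic f -> cont_periodic g ->
  cont_periodic (fun x => a * f x + g x).
Proof.
move=> [fc fp] [gc gp]; split; last by move=> x k; rewrite fp gp.
apply: unif_cont_continuous; apply: unif_cont_lin; exact: periodic_unif_cont.
Qed.

Lemma mean_dist f g B : cont_periodic f -> cont_periodic g ->
  (forall x, `|f x - g x| <= B) -> `|mean f - mean g| <= B.
Proof.
move=> fP gP fgB; have := mean_lin (-1) gP fP; rewrite mulN1r addrC => <-.
by apply: mean_bound (cont_periodic_lin (-1) gP fP) _ => x; rewrite mulN1r addrC.
Qed.

End mean.

Lemma norm_eq0_small (R : realType) (x : R) : (forall e : R, 0 < e -> `|x| <= e) -> x = 0.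
Proof.
move=> H; apply/eqP; rewrite -normr_le0; apply/ler_addgt0Pl => e e0.
by rewrite addr0; exact: H.
Qed.

(** * The cycle of implications *)
Section cycle.
Context {R : realType} {d : nat}.
Local Notation V := 'rV[R]_d.
Implicit Types (f g u psi : V -> R) (e s t a : R) (x y : V).
Variables (b : V -> V) (X : R -> V -> V) (mu : probability (borelRV R d) R).
Hypotheses (hb : C1_periodic_field b) (hX : is_flow b X) (hmu : torus_measure mu).
Local Notation mean := (mean mu).

Lemma cont_periodic_flow f t : cont_periodic f -> cont_periodic (flow_op X t f).
Proof.
move=> [fc fp]; split; last by move=> x k; rewrite /flow_op (flow_shift hb hX) fp.
have fu := periodic_unif_cont fc fp; apply: unif_cont_continuous => e e0.
have [r r0 fr] := fu e e0; have [L L0 XL] := flow_lipschitz hb hX t.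
have L1 : 0 < L + 1 by lra.
exists (r / (L + 1)); first exact: divr_gt0.
move=> x y; rewrite ler_pdivlMr// => xy; apply: fr; apply: le_trans (XL x y) _.
by apply: le_trans xy; rewrite mulrC ler_wpM2l//; lra.
Qed.

Lemma dot_grad_cont f : Ck 1 f -> continuous (fun x => dot (b x) (grad f x)).
Proof.
move=> fC.
have -> : (fun x => dot (b x) (grad f x)) = (fun x => \sum_i b x ord0 i * partial i f x).
  by apply/funext => x; apply: eq_bigr => i _; rewrite mxE.
apply: (continuous_sum (F := fun i x => b x ord0 i * partial i f x)) => i x.
have [[bc _] _] := hb i.
have pc : continuous (partial i f) by exact: Ck1_partial_continuous.
exact: (continuousM (bc x) (pc x)).
Qed.

Lemma dot_grad_cont_periodic f : Ck_periodic 1 f ->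
  cont_periodic (fun x => dot (b x) (grad f x)).
Proof.
move=> [fC fp]; split; first exact: dot_grad_cont.
move=> x k; rewrite (field_periodic hb); apply: eq_bigr => i _.
by rewrite !mxE partial_periodic.
Qed.

(** Since the expansion along the flow is uniform in the starting point, it can
    be integrated directly, without differentiating under the integral sign. *)
Lemma flow_mean_expansion f g : cont_periodic f -> cont_periodic g ->
  flow_derivative X f g -> forall e, 0 < e -> exists2 r : R, 0 < r &
    forall s, `|s| <= r -> `|mean (flow_op X s f) - mean f - s * mean g| <= e * `|s|.
Proof.
move=> fP gP fg e e0; have [r r0 H] := fg e e0; exists r => // s sr.
have -> : mean (flow_op X s f) - mean f - s * mean g =
    mean (flow_op X s f) - mean (fun x => s * g x + f x).
  by rewrite (mean_lin hmu)//; ring.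
apply: (mean_dist hmu); [exact: cont_periodic_flow|exact: cont_periodic_lin|].
by move=> x; have := H s x sr; congr (`|_| <= _); rewrite /flow_op; ring.
Qed.

Lemma invariant_meanP : invariant_measure X mu <->
  forall t psi, cont_periodic psi -> mean (flow_op X t psi) = mean psi.
Proof.
split=> [inv t psi psiP|H t psi psiP].
  have := inv t psi psiP; rewrite !(mean_integral hmu)//; first by case.
  exact: cont_periodic_flow.
by rewrite !(mean_integral hmu)// ?H//; exact: cont_periodic_flow.
Qed.

Lemma invariant_mean_dot_grad : invariant_measure X mu ->
  forall psi, Ck_periodic 1 psi -> mean (fun y => dot (b y) (grad psi y)) = 0.
Proof.
move=> /invariant_meanP inv psi psiC; apply: norm_eq0_small => e e0.
have psiP : cont_periodic psi by case: psiC => -[].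
have [r r0 /(_ r)] := flow_mean_expansion psiP (dot_grad_cont_periodic psiC)
  (C1_flow_derivative hb hX psiC) e0.
rewrite inv// subrr sub0r normrN normrM gtr0_norm// mulrC ler_pM2r//; exact.
Qed.

(** The expansion at time 0 applies to f o X_t, because X_(s+t) = X_s o X_t. *)
Lemma flow_mean_derive f g t : cont_periodic f -> cont_periodic g ->
  flow_derivative X f g ->
  is_derive t 1 (fun t => mean (flow_op X t f)) (mean (flow_op X t g)).
Proof.
move=> fP gP fg; pose I s := mean (flow_op X s f).
have H := flow_mean_expansion (cont_periodic_flow t fP) (cont_periodic_flow t gP)
  (flow_derivative_shift hb hX t fg).
have I_add s : mean (flow_op X s (flow_op X t f)) = I (s + t).
  by congr mean; apply/funext => x; rewrite /flow_op (flow_add hb hX).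
suff C : h^-1 *: (I (h *: (1 : R) + t) - I t) @[h --> 0^'] --> mean (flow_op X t g).
  by apply: DeriveDef; [apply/cvg_ex; eexists; exact: C|exact: cvg_lim C].
apply/cvgrPdist_le => e e0; have [r r0 Hr] := H e e0.
near=> h.
have h0 : h != 0 by near: h; exact: nbhs_dnbhs_neq.
have hr : `|h| <= r by near: h; exact: dnbhs0_le.
have := Hr h hr; rewrite I_add [h *: 1]mulr1 -/(I t) => K.
rewrite -(ler_pM2r (_ : 0 < `|h|)) ?normr_gt0//; apply: le_trans K.
rewrite -normrM -normrN le_eqVlt; apply/orP; left; apply/eqP; congr `|_|.
by rewrite mulrBl [_ *: _ * h]mulrAC mulVf// mul1r opprB [_ * h]mulrC.
Unshelve. all: by end_near. Qed.


Lemma box_avg_Ck_periodic h f : 0 < h -> cont_periodic f -> Ck_periodic 1 (box_avg h f).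
Proof.
move=> h0 [fc fp]; have fu := periodic_unif_cont fc fp.
have TT := @transl_op_box R d h h0.
split; last first.
  move=> x k; rewrite -(transl_op_shift TT); congr (box_avg h _ x).
  by apply/funext => y; rewrite fp.
split; first exact: unif_cont_continuous (transl_op_unif_cont TT fu).
move=> i; have [C [T [TT' fT]]] := box_unif_partial i h0 fu; split.
  by move=> x; have [] := unif_partial_derive x fT.
suff -> : partial i (box_avg h f) = T f.
  exact: unif_cont_continuous (transl_op_unif_cont TT' fu).
by apply/funext => x; have [_ H] := unif_partial_derive x fT; exact: H.
Qed.

Lemma C1_dense f e : 0 < e -> cont_periodic f ->
  exists2 g, Ck_periodic 1 g & forall x, `|g x - f x| <= e.
Proof.
move=> e0 fP; have [fc fp] := fP; have fu := periodic_unif_cont fc fp.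
have [r r0 fr] := fu e e0; have d1 : 0 < d%:R + 1 :> R by rewrite ltr_wpDl ?ler0n.
have h0 : 0 < r / (d%:R + 1) by exact: divr_gt0.
exists (box_avg (r / (d%:R + 1)) f); first exact: box_avg_Ck_periodic.
move=> x; apply: box_local => // z zr; apply: fr; rewrite addrAC subrr add0r.
apply: le_trans zr _; rewrite mulrA ler_pdivrMr// mulrC ler_wpM2l//; lra.
Qed.

(** Condition (b) for mollifications of Lipschitz functions: this is what (a)
    yields directly, and it already implies invariance. *)
Definition smooth_stationary := forall eps L u, 0 < eps -> d%:R * eps <= 1 -> 0 <= L ->
  lipschitz_with L u -> Defs.periodic u ->
  mean (fun y => dot (b y) (grad (smooth eps 0%N u) y)) = 0.

Lemma smooth_Ck_periodic eps L u : 0 < eps -> 0 <= L ->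
  lipschitz_with L u -> Defs.periodic u -> Ck_periodic 1 (smooth eps 0%N u).
Proof.
move=> eps0 L0 uL up; split; first exact: (smooth_Ck eps0 L0 uL).
move=> x k; rewrite -(smooth_shift eps0); congr (smooth eps 0%N _ x).
by apply/funext => y; rewrite up.
Qed.

(** f o X_t is Lipschitz and has (b . grad f) o X_t as derivative along the
    flow, so the commutator estimate identifies the latter with the limit of
    b . grad (M (f o X_t)), whose means vanish. *)
Lemma smooth_stationary_flow_mean f t : smooth_stationary -> Ck_periodic 1 f ->
  mean (flow_op X t (fun y => dot (b y) (grad f y))) = 0.
Proof.
move=> stat fC; apply: norm_eq0_small => e e0.
have gP := cont_periodic_flow t (dot_grad_cont_periodic fC).
have fP : cont_periodic f by case: fC => -[].
have [_ up] := cont_periodic_flow t fP.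
have [L0 L00 fL] := periodic_C1_lipschitz fC; have [L1 L10 XL] := flow_lipschitz hb hX t.
have uL : lipschitz_with (L0 * L1) (flow_op X t f).
  move=> x y; apply: le_trans (fL _ _) _; rewrite -mulrA ler_wpM2l//; exact: XL.
have L : 0 <= L0 * L1 by exact: mulr_ge0.
have [eps0 eps00 H] := smooth_flow_derivative hb hX L uL
  (periodic_unif_cont gP.1 gP.2)
  (flow_derivative_shift hb hX t (C1_flow_derivative hb hX fC)) e0.
have d1 : 0 < d%:R + 1 :> R by rewrite ltr_wpDl ?ler0n.
pose eps := Num.min eps0 (d%:R + 1)^-1.
have epsgt0 : 0 < eps by rewrite lt_min eps00 invr_gt0.
have epsd : d%:R * eps <= 1.
  apply: (@le_trans _ _ (d%:R * (d%:R + 1)^-1)).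
    by rewrite ler_wpM2l ?ler0n// ge_min lexx orbT.
  by rewrite ler_pdivrMr// mul1r lerDl.
rewrite -normrN -sub0r -(stat _ _ _ epsgt0 epsd L uL up).
apply: (mean_dist hmu) => //.
  exact: dot_grad_cont_periodic (smooth_Ck_periodic epsgt0 L uL up).
by move=> x; apply: H => //; rewrite ge_min lexx.
Qed.

(** The mean of f o X_t has zero derivative in t for f of class C^1; general
    continuous functions follow by density, the mean being 1-Lipschitz for the
    sup norm. *)
Lemma smooth_stationary_invariant : smooth_stationary -> invariant_measure X mu.
Proof.
move=> stat; apply/invariant_meanP => t psi psiP.
have C1_inv f : Ck_periodic 1 f -> mean (flow_op X t f) = mean f.
  move=> fC; have fP : cont_periodic f by case: fC => -[].
  have fE : mean (flow_op X 0 f) = mean f.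
    by congr mean; apply/funext => x; rewrite /flow_op (flow0 hX).
  rewrite -fE; apply: (@is_derive_0_is_cst _ (fun t => mean (flow_op X t f))) => s.
  rewrite -(smooth_stationary_flow_mean s stat fC).
  exact: flow_mean_derive fP (dot_grad_cont_periodic fC) (C1_flow_derivative hb hX fC).
apply/eqP; rewrite -subr_eq0; apply/eqP; apply: norm_eq0_small => e e0.
have e2 : 0 < e / 2 by rewrite divr_gt0.
have [f fC fpsi] := C1_dense e2 psiP.
have fP : cont_periodic f by case: fC => -[].
have -> : mean (flow_op X t psi) - mean psi =
   (mean f - mean psi) - (mean (flow_op X t f) - mean (flow_op X t psi)).
  by rewrite (C1_inv f fC); ring.
rewrite (le_trans (ler_normB _ _))// [leRHS](splitr e) lerD//.
  exact: (mean_dist hmu).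
by apply: (mean_dist hmu) => [||x]; [exact: cont_periodic_flow..|exact: fpsi].
Qed.

Variable mut : {measure set (borelRV R d) -> \bar R}.
Hypothesis hmut : is_lift mu mut.

Lemma integral_dot_grad_lift phi : Ck 1 phi -> compactly_supported phi ->
  (\int[mut]_x (dot (b x) (grad phi x))%:E =
   \int[mu]_(y in unit_cube R d) (dot (b y) (grad (periodization phi) y))%:E)%E.
Proof.
move=> phiC /compactly_supportedP[r r0 phi0].
have [_ ->] := hmut; last first.
  split; first exact: dot_grad_cont.
  apply/compactly_supportedP; exists r => // x xr.
  by rewrite /dot big1// => i _; rewrite mxE (partial_vanishes i phi0)// mulr0.
apply: eq_integral => y _; congr (_%:E).
apply: periodization_dot_grad phi0 _ _; first exact: Ck1_partially_derivable.
exact: (field_periodic hb).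
Qed.

Lemma mean_dot_grad_div_zero :
  (forall psi, Ck_periodic 1 psi -> mean (fun y => dot (b y) (grad psi y)) = 0) ->
  div_zero mut b.
Proof.
move=> H phi [phiC phis]; rewrite (integral_dot_grad_lift (phiC 1%N) phis).
have /compactly_supportedP[r r0 phi0] := phis.
have perC := periodization_C1 phi0 (phiC 1%N).
by rewrite (mean_integral hmu) ?H//; exact: dot_grad_cont_periodic.
Qed.

Lemma div_zero_smooth_stationary : div_zero mut b -> smooth_stationary.
Proof.
move=> div eps L u eps0 epsd L0 uL up.
have [cC cs] := smooth_cell_test eps0 epsd L0 uL up.
have := div _ (conj cC cs); rewrite (integral_dot_grad_lift (cC 1%N) cs).
have -> : periodization (smooth_cell eps u) = smooth eps 0%N u.
  by apply/funext => y; exact: periodization_smooth_cell uL up y.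
rewrite (mean_integral hmu); first by case.
exact: dot_grad_cont_periodic (smooth_Ck_periodic eps0 L0 uL up).
Qed.

End cycle.

Theorem theorem2p2 (R : realType) (d : nat) (hd : (1 <= d)%N)
  (b : 'rV[R]_d -> 'rV[R]_d) (hb : C1_periodic_field b)
  (X : R -> 'rV[R]_d -> 'rV[R]_d) (hX : is_flow b X)
  (mu : probability (borelRV R d) R) (hmu : torus_measure mu)
  (mut : {measure set (borelRV R d) -> \bar R}) (hmut : is_lift mu mut) :
  (invariant_measure X mu <-> div_zero mut b) /\
  (invariant_measure X mu <->
     forall psi : 'rV[R]_d -> R, Ck_periodic 1 psi ->
       (\int[mu]_(y in unit_cube R d) (dot (b y) (grad psi y))%:E = 0)%E).
Proof.
have weakP : (forall psi : 'rV[R]_d -> R, Ck_periodic 1 psi ->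
       (\int[mu]_(y in unit_cube R d) (dot (b y) (grad psi y))%:E = 0)%E) <->
  (forall psi : 'rV[R]_d -> R, Ck_periodic 1 psi ->
     mean mu (fun y => dot (b y) (grad psi y)) = 0).
  split=> H psi psiC; have := H psi psiC;
    rewrite (mean_integral hmu)//; do ?exact: dot_grad_cont_periodic.
    by case.
  by move=> ->.
have inv_weak := invariant_mean_dot_grad hb hX hmu.
have weak_div := mean_dot_grad_div_zero hb hmu hmut.
have div_inv : div_zero mut b -> invariant_measure X mu.
  move=> div; apply: (smooth_stationary_invariant hb hX hmu).
  exact: (div_zero_smooth_stationary hb hmu hmut div).
split; split.
- by move=> /inv_weak/weak_div.
- exact: div_inv.
- by move=> /inv_weak/weakP.
- by move=> /weakP/weak_div/div_inv.
Qed.
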